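(* Let $n\ge 1$, $\alpha\in(0,2]$, $\beta>0$, and let $X_{\alpha,\beta}(t)$, $t\in\mathbb{R}^n$, be the Gaussian field with generalized Cauchy covariance (GFGCC), i.e. the centered stationary Gaussian field with covariance $(1+\Vert\tau\Vert^{\alpha})^{-\beta}$. Then $X_{\alpha,\beta}$ is a locally asymptotically self-similar (lass) random field of order $\alpha/2$, and its tangent field is the Lévy fractional Brownian field of index $\alpha/2$.
   Context: $\Vert\cdot\Vert$ is the Euclidean norm on $\mathbb{R}^n$ and $\langle\cdot\rangle$ denotes expectation. The GFGCC $X_{\alpha,\beta}(t)$, $t\in\mathbb{R}^n$, is the stationary Gaussian field with mean zero and covariance $\langle X_{\alpha,\beta}(t+\tau)X_{\alpha,\beta}(t)\rangle=(1+\Vert\tau\Vert^{\alpha})^{-\beta}$. A random field $X(t)$ is lass at a point $t_0$ with order $\kappa$ if, as $\varepsilon\to0^+$, $\{\varepsilon^{-\kappa}(X(t_0+\varepsilon u)-X(t_0))\}_{u\in\mathbb{R}^n}$ converges in the sense of finite-dimensional distributions to a nontrivial field $T_{t_0}(u)$, called the tangent field of $X$ at $t_0$. The Lévy fractional Brownian field $B_{\alpha/2}(u)$, $u\in\mathbb{R}^n$, of index $\alpha/2$ is the centered Gaussian field with covariance $\langle B_{\alpha/2}(u)B_{\alpha/2}(v)\rangle=\frac12\left(\Vert u\Vert^{\alpha}+\Vert v\Vert^{\alpha}-\Vert u-v\Vert^{\alpha}\right)$.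
   Formalization: The tangent field is stated as √(2β) times the Lévy fractional Brownian field of index α/2, since the increments' rescaled variance tends to 2β‖u‖^α while the Lévy field has variance ‖u‖^α; the literal claim holds only for β = 1/2. *)

(* Defs.v *)
From HB Require Import structures.
From mathcomp Require Import all_boot all_order all_algebra.
From mathcomp Require Import all_classical all_reals all_analysis.

Set Implicit Arguments.
Unset Strict Implicit.
Unset Printing Implicit Defensive.
Import Order.TTheory GRing.Theory Num.Theory.
Import numFieldNormedType.Exports.
Local Open Scope classical_set_scope.
Local Open Scope ring_scope.

(* The library norm of ['rV[R]_n] is the sup norm, hence this definition. *)
Definition eucl_norm (R : realType) (n : nat) (x : 'rV[R]_n) : R :=
  Num.sqrt (\sum_(i < n) x ord0 i ^+ 2).

(* The normal law with mean m and standard deviation s; for s = 0 it is the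
   Dirac mass at m, whereas [normal_prob m 0] is a junk value. *)
Definition gaussian_law (R : realType) (m s : R) (A : set R) : \bar R :=
  if s == 0 then \d_m A else normal_prob m s A.

Definition random_field (R : realType) (n : nat) (d : measure_display)
    (Omega : measurableType d) (P : probability Omega R) : Type :=
  'rV[R]_n -> {RV P >-> R}.

Definition gaussian_field (R : realType) (n : nat) (d : measure_display)
    (Omega : measurableType d) (P : probability Omega R)
    (X : random_field n P) : Prop :=
  forall (k : nat) (t : 'I_k -> 'rV[R]_n) (c : 'I_k -> R),
  exists m s : R, forall A : set R, measurable A ->
    P ((fun w => \sum_(i < k) c i * X (t i) w) @^-1` A) = gaussian_law m s A.

Definition centered_field (R : realType) (n : nat) (d : measure_display)
    (Omega : measurableType d) (P : probability Omega R)
    (X : random_field n P) : Prop :=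
  forall t, ('E_P[X t] = 0)%E.

(* Stationarity is not a separate clause: for a centered Gaussian field it is
   the fact that the covariance depends on the lag tau only. *)
Definition gfgcc (R : realType) (n : nat) (alpha beta : R)
    (d : measure_display) (Omega : measurableType d) (P : probability Omega R)
    (X : random_field n P) : Prop :=
  [/\ gaussian_field X, centered_field X &
      forall t tau : 'rV[R]_n,
        ('E_P[fun w => (X (t + tau)%R w * X t w)%R] =
         ((1 + eucl_norm tau `^ alpha) `^ (- beta))%:E)%E].

Definition levy_fbf (R : realType) (n : nat) (H : R)
    (d : measure_display) (Omega : measurableType d) (P : probability Omega R)
    (B : random_field n P) : Prop :=
  [/\ gaussian_field B, centered_field B &
      forall u v : 'rV[R]_n,
        ('E_P[fun w => (B u w * B v w)%R] =
         (2^-1 * (eucl_norm u `^ (2 * H) + eucl_norm v `^ (2 * H)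
                  - eucl_norm (u - v) `^ (2 * H)))%:E)%E].

(* Convergence of finite-dimensional distributions as eps -> 0+, where
   [Y eps] is a field for each eps: weak convergence of the laws of
   (Y eps u_0, ..., Y eps u_(k-1)), tested on bounded continuous functions.
   The limit field T may live on another probability space. *)
Definition fdd_cvg (R : realType) (n : nat)
    (d : measure_display) (Omega : measurableType d) (P : probability Omega R)
    (Y : R -> 'rV[R]_n -> Omega -> R)
    (d' : measure_display) (Omega' : measurableType d')
    (Q : probability Omega' R) (T : random_field n Q) : Prop :=
  forall (k : nat) (u : 'I_k -> 'rV[R]_n) (f : 'rV[R]_k -> R),
    continuous f -> (exists M : R, forall x, `|f x| <= M) ->
    ('E_P[fun w => f (\row_(i < k) Y eps (u i) w)] @[eps --> (0 : R)^'+]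
       --> 'E_Q[fun w => f (\row_(i < k) T (u i) w)])%E.

(* T is not a version of the zero field. *)
Definition nontrivial_field (R : realType) (n : nat) (d : measure_display)
    (Omega : measurableType d) (P : probability Omega R)
    (T : random_field n P) : Prop :=
  exists u, ~ {ae P, forall w, T u w = 0}.

Definition tangent_field (R : realType) (n : nat)
    (d : measure_display) (Omega : measurableType d) (P : probability Omega R)
    (X : random_field n P) (t0 : 'rV[R]_n) (kappa : R)
    (d' : measure_display) (Omega' : measurableType d')
    (Q : probability Omega' R) (T : random_field n Q) : Prop :=
  nontrivial_field T /\
  fdd_cvg P
    (fun eps u w => eps `^ (- kappa) * (X (t0 + eps *: u) w - X t0 w)) T.

Definition lass_at (R : realType) (n : nat)
    (d : measure_display) (Omega : measurableType d) (P : probability Omega R)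
    (X : random_field n P) (t0 : 'rV[R]_n) (kappa : R) : Prop :=
  exists (d' : measure_display) (Omega' : measurableType d')
    (Q : probability Omega' R) (T : random_field n Q),
    tangent_field X t0 kappa T.

(* Main.v *)
Require Import Defs.
From HB Require Import structures.
From mathcomp Require Import all_boot all_order all_algebra.
From mathcomp Require Import all_classical all_reals all_analysis.
From mathcomp Require Import measurable_realfun.
From mathcomp Require Import ring lra.

Import Order.TTheory GRing.Theory Num.Theory.
Import numFieldNormedType.Exports.
Local Open Scope classical_set_scope.
Local Open Scope ring_scope.

Set Implicit Arguments.
Unset Strict Implicit.
Unset Printing Implicit Defensive.

(** Write Y_eps(u) = eps^(-alpha/2) (X(t0 + eps u) - X(t0)). A linear combination of the Y_eps(u_i)
    is a linear combination of values of [X], hence a centered Gaussian variable whose law is fixed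
    by its variance. Since (1 + y)^(-beta) has slope -beta at 0, the covariance of Y_eps tends to
    beta (|u|^alpha + |v|^alpha - |u - v|^alpha), which is 2 beta times the Lévy covariance
    ([increment_cov_cvg]). So the linear combinations of any tangent field have prescribed Gaussian
    laws ([converging_comb]), polarization yields its covariance ([converging_cov]), and division by
    sqrt(2 beta) gives a Lévy field.

    It remains to produce a limit field and to prove convergence for all bounded continuous test
    functions. The field is built on a Loeb space. Along an ultrafilter U finer than convergence at
    infinity, the ultrapower of [Omega] carries a probability ([loeb_measure_exists]) for which
    integrals of uniformly bounded functions commute with U-limits ([loeb_integral]). The increments
    are tight by Chebyshev ([increment_tight]), so their U-limits are finite almost surely and form
    a field to which the increments converge in law along U ([loeb_field_expectation]). Positivity
    of the limit variances is inherited from the variances of Y_eps.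

    A sequence converges as soon as it converges to the same limit along every finer ultrafilter
    ([ultra_cvg]). Loeb limits along different ultrafilters live on different spaces, but their
    linear combinations have the same Gaussian laws, so they integrate every cos(c.x + th) alike.
    These cosines determine the integrals of all bounded continuous functions ([trig_determining]),
    by Bernstein approximation in the variables sin(x_i / L) followed by L to infinity. *)

(** * Bounded random variables and bounded convergence *)

Section BoundedVariables.
Context {R : realType} {d : measure_display} {T : measurableType d}
  (P : probability T R).
Implicit Types f g : T -> R.

Definition bounded_rv f :=
  measurable_fun setT f /\ exists M : R, forall x, `|f x| <= M.

Lemma bounded_rv_integrable f : bounded_rv f -> P.-integrable setT (EFin \o f).
Proof.
move=> [mf [M fM]]; apply: measurable_bounded_integrable => //.
  by rewrite (le_lt_trans (probability_le1 P measurableT))// ltry.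
by exists M; split; [exact: num_real|move=> N /ltW MN x _; exact: le_trans (fM x) MN].
Qed.

Lemma expectation_bounded f : bounded_rv f -> ('E_P[f] = (\int[P]_w f w)%R%:E)%E.
Proof.
by move=> bf; rewrite unlock fineK// integrable_fin_num//; exact: bounded_rv_integrable.
Qed.

Lemma bounded_rv_cst (r : R) : bounded_rv (cst r).
Proof. by split; [exact: measurable_cst|exists `|r|]. Qed.

Lemma bounded_rvD f g : bounded_rv f -> bounded_rv g -> bounded_rv (f \+ g).
Proof.
move=> [mf [M fM]] [mg [N gN]]; split; first exact: measurable_funD.
by exists (M + N) => x; rewrite (le_trans (ler_normD _ _))// lerD.
Qed.

Lemma bounded_rvM f g : bounded_rv f -> bounded_rv g -> bounded_rv (f \* g).
Proof.
move=> [mf [M fM]] [mg [N gN]]; split; first exact: measurable_funM.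
by exists (M * N) => x; rewrite normrM ler_pM.
Qed.

Lemma bounded_rv_sum (I : Type) (s : seq I) (F : I -> T -> R) :
  (forall i, bounded_rv (F i)) -> bounded_rv (fun x => \sum_(i <- s) F i x).
Proof.
move=> bF; elim: s => [|i s ih].
  by rewrite (_ : (fun _ => _) = cst 0); [exact: bounded_rv_cst|apply/funext => x; rewrite big_nil].
rewrite (_ : (fun _ => _) = F i \+ (fun x => \sum_(i <- s) F i x)); first exact: bounded_rvD.
by apply/funext => x; rewrite big_cons.
Qed.

Lemma bounded_rv_indic (A : set T) : measurable A -> bounded_rv \1_A.
Proof.
move=> mA; split; first exact: measurable_indic.
by exists 1 => x; rewrite indicE; case: (_ \in _); rewrite ?normr0 ?normr1.
Qed.

Lemma Rintegral_sum (I : Type) (s : seq I) (F : I -> T -> R) :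
  (forall i, bounded_rv (F i)) ->
  \int[P]_x (\sum_(i <- s) F i x) = \sum_(i <- s) \int[P]_x F i x.
Proof.
move=> bF; elim: s => [|i s ih].
  under eq_Rintegral do rewrite big_nil.
  by rewrite big_nil Rintegral_cst// mul0r.
under eq_Rintegral do rewrite big_cons.
rewrite big_cons RintegralD// ?ih//; apply: bounded_rv_integrable => //.
exact: bounded_rv_sum.
Qed.

Lemma RintegralZ_bounded (a : R) f : bounded_rv f ->
  \int[P]_x (a * f x) = a * \int[P]_x f x.
Proof. by move=> bf; rewrite RintegralZl//; exact: bounded_rv_integrable. Qed.

Lemma Rintegral_prob_cst (r : R) : \int[P]_x r = r.
Proof. by rewrite Rintegral_cst// [fine _](_ : _ = 1) ?mulr1//= probability_setT. Qed.

Lemma le_dist_Rintegral f g (e : R) : bounded_rv f -> bounded_rv g ->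
  (forall x, `|f x - g x| <= e) -> `|\int[P]_x f x - \int[P]_x g x| <= e.
Proof.
move=> bf bg fg.
have bN : bounded_rv (fun x => f x - g x).
  rewrite (_ : (fun _ => _) = f \+ (cst (-1) \* g)).
    by apply: bounded_rvD => //; apply: bounded_rvM => //; exact: bounded_rv_cst.
  by apply/funext => x /=; rewrite mulN1r.
rewrite -RintegralB//; [|exact: bounded_rv_integrable..].
rewrite (le_trans (le_normr_Rintegral _ _))//; first exact: bounded_rv_integrable.
rewrite -[leRHS]Rintegral_prob_cst; apply: le_Rintegral => //; last first.
  exact: (bounded_rv_integrable (bounded_rv_cst e)).
apply: bounded_rv_integrable; split; first exact: measurableT_comp bN.1.
by exists e => x; rewrite normr_id.
Qed.

(** Dominated convergence with a constant majorant. Boundedness and measurability of [f] are part of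
    the conclusion because [f] is typically known only as a pointwise limit. *)
Lemma bounded_convergence (f_ : nat -> T -> R) f (M : R) :
  (forall n, measurable_fun setT (f_ n)) -> (forall n x, `|f_ n x| <= M) ->
  (forall x, f_ n x @[n --> \oo] --> f x) ->
  bounded_rv f /\ \int[P]_x f_ n x @[n --> \oo] --> \int[P]_x f x.
Proof.
move=> mf fM cf.
have bf : bounded_rv f.
  split; first by apply: (measurable_fun_cvg mf) => x _; exact: cf.
  exists M => x; rewrite -(cvg_lim _ (cvg_norm (cf x)))//.
  by apply: limr_le; [apply/cvg_ex; eexists; exact: (cvg_norm (cf x))|exact: nearW].
split=> //; rewrite /Rintegral; apply: fine_cvg.
rewrite fineK; last by apply: integrable_fin_num => //; exact: bounded_rv_integrable.
have [] // := @dominated_convergence _ T R P setT measurableT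
  (fun n => EFin \o f_ n) (EFin \o f) (cst M%:E).
- by move=> n; apply/measurable_EFinP.
- by apply/measurable_EFinP; exact: bf.1.
- by apply: aeW => x _; apply/fine_cvgP; split; [exact: nearW|exact: cf].
- exact: (bounded_rv_integrable (bounded_rv_cst M)).
- by apply: aeW => x n _ /=; rewrite lee_fin.
Qed.

End BoundedVariables.

(** * Limits along an ultrafilter *)

Section Ultralimit.
Context {R : realType} {I : Type} (U : set_system I) {uU : UltraFilter U}.

Lemma near_or (A B : set I) :
  (\forall i \near U, A i \/ B i) -> (\forall i \near U, A i) \/ (\forall i \near U, B i).
Proof.
move=> AB; have [UA|UA] := in_ultra_setVsetC A uU; first by left.
by right; apply: filterS2 AB UA => i [Ai /(_ Ai)|].
Qed.

Lemma near_not (A : set I) : ~ (\forall i \near U, A i) -> \forall i \near U, ~ A i.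
Proof. by move=> nA; have [|//] := in_ultra_setVsetC A uU. Qed.

(** The image filter is refined to an ultrafilter [G] containing the compact segment [-M, M], so [G]
    converges. A set of [G] has its preimage in [U], for otherwise its complement would also belong
    to [G]. *)
Lemma bounded_ultra_cvg (x : I -> R) (M : R) : (forall i, `|x i| <= M) ->
  x i @[i --> U] --> lim (x i @[i --> U]).
Proof.
move=> xM; apply/cvg_ex.
have [G [uG FG]] := ultraFilterLemma (fmap_proper_filter x (@ultra_proper _ _ uU)).
have GM : G `[-M, M]%classic.
  by apply: FG; apply: nearW => i /=; rewrite in_itv/= -ler_norml.
have : compact `[-M, M]%classic by exact: segment_compact.
rewrite compact_ultra => /(_ G uG GM)[l [_ Gl]]; exists l => B /Gl GB.
have [//|UnB] := in_ultra_setVsetC (x @^-1` B) uU.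
by have /filter_ex[y []] : G (B `&` ~` B) by apply: filterI => //; exact: FG.
Qed.

End Ultralimit.

(* Loeb's construction: the internal sets of the ultrapower of [Omega]
   form an algebra on which the ultralimit of [P] is sigma-additive by
   countable saturation. *)
Definition ultrapower (I : Type) (U : set_system I) (uU : UltraFilter U)
  d (Omega : measurableType d) : Type := I -> Omega.

(** * Internal sets of the ultrapower *)

Section Internal.
Context {I : Type} {U : set_system I} (uU : UltraFilter U)
  {d : measure_display} (Omega : measurableType d).
Local Notation W := (ultrapower uU Omega).

Definition internal (A : I -> set Omega) : set W :=
  [set w | \forall i \near U, A i (w i)].

Definition internal_sets : set (set W) :=
  [set internal A | A in [set A | forall i, measurable (A i)]].

Lemma internalC A : ~` internal A = internal (fun i => ~` A i).
Proof.
apply/seteqP; split => w; first by move/near_not.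
by move=> h1 h2; have /filter_ex[i []] : U ((fun i => ~ A i (w i)) `&` (fun i => A i (w i)))
  by exact: filterI.
Qed.

Lemma internalU A B : internal A `|` internal B = internal (fun i => A i `|` B i).
Proof.
apply/seteqP; split => w; last exact: near_or.
by move=> [] h; apply: filterS h => i; [left|right].
Qed.

Lemma internal0 : internal (fun=> set0) = set0.
Proof. by apply/seteqP; split => w // /filter_ex[]. Qed.

(** If the inclusion failed for U-almost all [i], a choice of points of [A i] outside [B i] would be
    an element of [internal A] that is not in [internal B]. *)
Lemma sub_internal (A B : I -> set Omega) : internal A `<=` internal B ->
  \forall i \near U, A i `<=` B i.
Proof.
move=> AB; apply: contrapT => /near_not nAB.
have /choice[w hw] : forall i, exists x, ~ (A i `<=` B i) -> A i x /\ ~ B i x.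
  move=> i; have [AiBi|] := pselect (A i `<=` B i); first by exists point.
  by move=> /existsNP[x /not_implyP[Ax Bx]]; exists x.
have /AB Bw : internal A w by apply: filterS nAB => i /hw[].
by have /filter_ex[i [Bi /hw[]]] :
  U ((fun i => B i (w i)) `&` (fun i => ~ (A i `<=` B i))) by exact: filterI.
Qed.

Let int0 : internal_sets set0.
Proof. by exists (fun=> set0); [move=> i; exact: measurable0|exact: internal0]. Qed.

Let intU : setU_closed internal_sets.
Proof.
move=> _ _ [A mA <-] [B mB <-]; rewrite internalU.
by exists (fun i => A i `|` B i) => // i; exact: measurableU.
Qed.

Let intC : setC_closed internal_sets.
Proof.
move=> _ [A mA <-]; rewrite internalC.
by exists (fun i => ~` A i) => // i; exact: measurableC.
Qed.

HB.instance Definition _ := Pointed.copy W (I -> Omega).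
HB.instance Definition _ :=
  isAlgebraOfSets.Build default_measure_display W int0 intU intC.

End Internal.

(** * The Loeb probability *)

Section Loeb.
Context {R : realType} {I : Type} {U : set_system I} {uU : UltraFilter U}
  {d : measure_display} {Omega : measurableType d} (P : probability Omega R).
(* Countable incompleteness of [U], which is what makes the ultrapower
   countably saturated. *)
Variable nu : I -> nat.
Hypothesis nuU : forall m, \forall i \near U, (m <= nu i)%N.
Local Notation W := (ultrapower uU Omega).
Local Notation int := (@internal I U uU d Omega).

(** Diagonal argument: if every [int (A n)] is nonempty, a point of the intersection is chosen
    coordinate by coordinate, meeting at coordinate [i] as many of the sets as possible up to level
    [nu i]. *)
Lemma saturation (A : nat -> I -> set Omega) :
  (forall n, int (A n.+1) `<=` int (A n)) ->
  \bigcap_n int (A n) = set0 -> exists n, int (A n) = set0.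
Proof.
move=> decr A0; apply: contrapT => /forallNP nA0.
have dec m n : (m <= n)%N -> int (A n) `<=` int (A m).
  elim: n => [|n ih]; first by rewrite leqn0 => /eqP->.
  by rewrite leq_eqVlt => /predU1P[->//|/ih mn]; exact: subset_trans (decr n) mn.
pose good i n := exists x, forall m, (m <= n)%N -> A m i x.
have goodU n : \forall i \near U, good i n.
  have /eqP/set0P[w Anw] := nA0 n.
  have : forall k, (k <= n.+1)%N ->
      \forall i \near U, forall m, (m < k)%N -> A m i (w i).
    elim=> [|k ih] kn; first exact: nearW.
    have Akw : int (A k) w by exact: (dec k n kn w Anw).
    near=> i => m; rewrite ltnS leq_eqVlt => /predU1P[->|]; first by near: i.
    by move: m; near: i; exact: ih (ltnW kn).
  by move=> /(_ _ (leqnn _)); apply: filterS => i h; exists (w i).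
(* [N i] is the largest good level not exceeding [nu i]; the cap [nu i] makes the maximum exist, and
   since it passes every [n] for U-almost all [i], so does [N i]. *)
have /choice[N hN] : forall i, exists N, forall n, good i n -> (n <= nu i)%N ->
    good i N /\ (n <= N)%N.
  move=> i; pose p n := `[< good i n >] && (n <= nu i)%N.
  have [exp|nexp] := pselect (exists n, p n); last first.
    by exists 0 => n gn ni; case: nexp; exists n; rewrite /p ni andbT; exact/asboolP.
  have pub n : p n -> (n <= nu i)%N by case/andP.
  exists (ex_maxn exp pub); case: ex_maxnP => N /andP[/asboolP gN _] maxN n gn ni.
  by split=> //; apply: maxN; rewrite /p ni andbT; exact/asboolP.
have /choice[w hw] : forall i, exists x, good i (N i) ->
    forall m, (m <= N i)%N -> A m i x.
  by move=> i; have [[x h]|] := pselect (good i (N i)); [exists x|exists point].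
have : (\bigcap_n int (A n)) w.
  move=> n _; rewrite /internal/=; near=> i.
  have [||gN nN] := @hN i n; [by near: i|by near: i|].
  exact: hw.
by rewrite A0.
Unshelve. all: by end_near. Qed.

Local Notation ulim x := (lim (x @ U)).


Lemma ulimP (A : I -> set Omega) : (forall i, measurable (A i)) ->
  fine (P (A i)) @[i --> U] --> lim (fine (P (A i)) @[i --> U]).
Proof.
move=> mA; apply: (@bounded_ultra_cvg _ _ _ _ _ 1) => i.
by rewrite ger0_norm ?fine_ge0// -lee_fin fineK ?fin_num_measure// probability_le1.
Qed.

Let rep (S : set W) : I -> set Omega :=
  xget (fun=> set0) [set A | (forall i, measurable (A i)) /\ S = int A].

Let repP (S : set W) : measurable S ->
  (forall i, measurable (rep S i)) /\ S = int (rep S).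
Proof.
by move=> [A mA SA]; apply: (@xgetPex _ _ [set A | (forall i, measurable (A i)) /\ S = int A]); exists A.
Qed.

(** The maximum with 0 makes nonnegativity immediate for every [S]; on internal sets it changes
    nothing. *)
Definition loeb_content (S : set W) : \bar R :=
  (Num.max 0 (lim (fine (P (rep S i)) @[i --> U])))%:E.

(** Independence of the representative: by [sub_internal], two families with the same internal set
    coincide at U-almost all coordinates, so their probabilities have the same limit. *)
Lemma loeb_contentE (A : I -> set Omega) : (forall i, measurable (A i)) ->
  loeb_content (int A) = (lim (fine (P (A i)) @[i --> U]))%:E.
Proof.
move=> mA; have mAS : measurable (int A : set W) by exists A.
have [mr AE] := repP mAS.
have -> : lim (fine (P (A i)) @[i --> U]) = lim (fine (P (rep (int A) i)) @[i --> U]).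
  apply/esym/cvg_lim => //; apply: cvg_trans (ulimP mA); apply: near_eq_cvg.
  have h1 : \forall i \near U, A i `<=` rep (int A) i.
    by apply: (sub_internal (uU := uU)); rewrite -AE.
  have h2 : \forall i \near U, rep (int A) i `<=` A i.
    by apply: (sub_internal (uU := uU)); rewrite -AE.
  near=> i; congr (fine (P _)); apply/seteqP; split; near: i => //.
rewrite /loeb_content max_r//; apply: limr_ge.
  by apply/cvg_ex; eexists; exact: ulimP.
by apply: nearW => i; rewrite fine_ge0.
Unshelve. all: by end_near. Qed.

Lemma loeb_content_ge0 (S : set W) : (0 <= loeb_content S)%E.
Proof. by rewrite lee_fin le_max lexx. Qed.

Lemma loeb_contentU (S S' : set W) : measurable S -> measurable S' ->
  S `&` S' = set0 -> loeb_content (S `|` S') = (loeb_content S + loeb_content S')%E.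
Proof.
move=> [A mA <-] [B mB <-] AB0; rewrite internalU !loeb_contentE//; last first.
  by move=> i; exact: measurableU.
rewrite -EFinD; congr EFin; apply/cvg_lim => //.
apply: cvg_trans (cvgD (ulimP mA) (ulimP mB)); apply: near_eq_cvg.
have : \forall i \near U, A i `<=` ~` B i.
  by apply: (sub_internal (uU := uU)); rewrite -internalC; exact/disjoints_subset.
apply: filterS => i /disjoints_subset ABi /=.
by rewrite measureU// fineD// fin_num_measure.
Qed.

Lemma loeb_content0 : loeb_content set0 = 0%E.
Proof.
rewrite -(internal0 uU Omega) loeb_contentE//.
by under eq_fun do rewrite measure0 /=; rewrite lim_cst.
Qed.

Lemma loeb_content_bigsetU (F : nat -> set W) : (forall k, measurable (F k)) ->
  trivIset setT F -> forall n,
  loeb_content (\big[setU/set0]_(k < n) F k) = (\sum_(0 <= k < n) loeb_content (F k))%E.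
Proof.
move=> mF tF; elim=> [|n ih]; first by rewrite big_ord0 big_nil loeb_content0.
rewrite big_ord_recr/= big_nat_recr//= -ih loeb_contentU//.
  by apply: bigsetU_measurable.
by apply: (@trivIset_bigsetUI _ xpredT) => // i j _ _; exact: tF.
Qed.

(** By saturation, a disjoint union of internal sets that is itself internal has only finitely many
    nonempty terms, so finite additivity suffices. *)
Lemma loeb_content_sigma_additive : semi_sigma_additive loeb_content.
Proof.
move=> F mF tF [B mB BE].
have mBF n : measurable (int B `\` \big[setU/set0]_(k < n) F k : set W).
  by apply: measurableD; [exists B|exact: bigsetU_measurable].
(* The remainders after removing the first [n] sets are internal, decreasing, and have empty
   intersection. *)
have /choice[A hA] n : exists A, int A = int B `\` \big[setU/set0]_(k < n) F k.
  by have [A _ AE] := mBF n; exists A.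
have [n|//|n An0] := @saturation A.
- rewrite !hA big_ord_recr/= => w [Bw nw]; split=> // Fw; apply: nw.
  by left.
- apply/seteqP; split => // w; rewrite /bigcap/= => Aw.
  have : int B w by have := Aw 0 Logic.I; rewrite hA => -[].
  rewrite BE => -[k _ Fkw]; have := Aw k.+1 Logic.I; rewrite hA => -[_]; apply.
  by rewrite big_ord_recr/=; right.
have BF : int B = \big[setU/set0]_(k < n) F k.
  apply/seteqP; split => w.
    move=> Bw; apply: contrapT => nw; suff : int (A n) w by rewrite An0.
    by rewrite hA.
  by rewrite BE -bigcup_mkord => -[k _ Fkw]; exists k.
have F0 m : (n <= m)%N -> F m = set0.
  move=> nm; apply/seteqP; split => // w Fmw.
  have : int B w by rewrite BE; exists m.
  rewrite BF -bigcup_mkord => -[k /= kn Fkw].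
  have km : k <> m by move=> km; move: kn; rewrite km ltnNge nm.
  have /trivIsetP/(_ k m Logic.I Logic.I) := tF.
  move=> /(_ (introN eqP km)) FkFm; have : (F k `&` F m) w by split.
  by rewrite FkFm.
rewrite -BE BF loeb_content_bigsetU//; apply: cvg_near_cst.
near=> m; have nm : (n <= m)%N by near: m; exists n.
rewrite (big_cat_nat (leq0n n) nm)//= [X in (_ + X)%E](_ : _ = 0%E) ?adde0//.
by rewrite big_nat big1// => k /andP[nk _]; rewrite F0// loeb_content0.
Unshelve. all: by end_near. Qed.

(** Carathéodory extension of the content to the sigma-algebra generated by the internal sets. *)
Lemma loeb_measure_exists : exists Q : probability (g_sigma_algebraType (@measurable _ W)) R,
  forall A, (forall i, measurable (A i)) ->
    Q (int A) = (lim (fine (P (A i)) @[i --> U]))%:E.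
Proof.
pose muM := isMeasure.Build _ W R loeb_content loeb_content0 loeb_content_ge0
  loeb_content_sigma_additive.
pose mu : {measure set W -> \bar R} := HB.pack loeb_content muM.
have extE A : (forall i, measurable (A i)) ->
    measure_extension mu (int A) = (lim (fine (P (A i)) @[i --> U]))%:E.
  move=> mA; rewrite /measure_extension measurable_mu_extE/=; last by exists A.
  exact: loeb_contentE.
have extT : measure_extension mu setT = 1%E.
  have -> : setT = int (fun=> setT).
    by apply/seteqP; split => // w _; rewrite /internal/=; exact: nearW.
  by rewrite extE//; under eq_fun do rewrite probability_setT/=; rewrite lim_cst.
pose QP := Measure_isProbability.Build _ _ _ (measure_extension mu) extT.
pose Q : probability (g_sigma_algebraType (@measurable _ W)) R :=
  HB.pack (measure_extension mu) QP.
by exists Q.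
Qed.


End Loeb.

(** * Layer sums and integration against the Loeb probability *)

Section LayerSums.
Context {R : realType}.

(** The sum counts the integers of [0, n) strictly below [z], which is the ceiling of [z]. *)
Lemma layer_count (n : nat) (z : R) : 0 <= z <= n%:R ->
  z <= \sum_(j < n) (j%:R < z)%R%:R <= z + 1.
Proof.
elim: n z => [|n ih] z /andP[z0 zn].
  by rewrite big_ord0 zn addr_ge0.
rewrite big_ord_recr/=; have [zn'|nz] := lerP z n%:R.
  by rewrite addr0 ih ?z0.
rewrite (eq_bigr (fun=> 1)); last first.
  by move=> j _; rewrite (le_lt_trans _ nz)// ler_nat ltnW.
by rewrite sumr_const card_ord natr1 zn -natr1 lerD2r ltW.
Qed.

(* The layer-cake approximation of [x], uniform on [-M, M]. *)
Definition layer (M : R) (n : nat) (A : nat -> bool) : R :=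
  - M + M * 2 / n%:R * \sum_(j < n) (A j)%:R.

Lemma layer_approx (M x : R) (n : nat) : 0 < M -> (0 < n)%N -> `|x| <= M ->
  `|layer M n (fun j => j%:R < (x + M) * (n%:R / (M * 2))) - x| <= M * 2 / n%:R.
Proof.
move=> M0 n0; rewrite ler_norml => /andP[Mx xM]; rewrite /layer.
set z := (x + M) * _; have n0R : 0 < n%:R :> R by rewrite ltr0n.
have zE : x = - M + M * 2 / n%:R * z.
  by rewrite /z; field; rewrite !gt_eqF.
have /layer_count : 0 <= z <= n%:R.
  rewrite /z mulrA ler_pdivrMr ?mulr_gt0// divr_ge0 ?mulr_ge0 ?ler0n//=; [|lra|lra].
  by rewrite mulrC ler_pM2l//; lra.
set s := \sum_(j < n) _; move=> /andP[zs sz].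
have c0 : 0 < M * 2 / n%:R by rewrite divr_gt0 ?mulr_gt0.
rewrite [X in _ - X]zE opprD addrACA subrr add0r -mulrBr normrM gtr0_norm//.
by rewrite ger_pMr// ger0_norm; lra.
Qed.

Lemma Rintegral_layer {d} {T : measurableType d} (P : probability T R) (M : R) n
    (A : nat -> set T) : (forall j, measurable (A j)) ->
  bounded_rv (fun w => layer M n (fun j => w \in A j)) /\
  \int[P]_w layer M n (fun j => w \in A j) =
    - M + M * 2 / n%:R * \sum_(j < n) fine (P (A j)).
Proof.
move=> mA.
have bs : bounded_rv (fun w => \sum_(j < n) (\1_(A j) w : R)).
  by apply: bounded_rv_sum => j; exact: bounded_rv_indic.
have bl : bounded_rv (fun w => M * 2 / n%:R * \sum_(j < n) (\1_(A j) w : R)).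
  exact: bounded_rvM (bounded_rv_cst _) bs.
split; first exact: bounded_rvD (bounded_rv_cst _) bl.
rewrite RintegralD//; [|exact: (bounded_rv_integrable _ (bounded_rv_cst _))|].
- rewrite Rintegral_prob_cst RintegralZ_bounded// Rintegral_sum; last first.
    by move=> j; exact: bounded_rv_indic.
  congr (_ + _ * _); apply: eq_bigr => j _.
  by rewrite /Rintegral integral_indic// setIT.
- exact: bounded_rv_integrable.
Qed.

End LayerSums.

Section LoebIntegral.
Context {R : realType} {I : Type} {U : set_system I} {uU : UltraFilter U}
  {d : measure_display} {Omega : measurableType d} (P : probability Omega R).
Local Notation W := (g_sigma_algebraType (@measurable _ (ultrapower uU Omega))).
Local Notation int := (@internal I U uU d Omega).
Variable Q : probability W R.
Hypothesis QE : forall A, (forall i, measurable (A i)) ->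
  Q (int A) = (lim (fine (P (A i)) @[i --> U]))%:E.

Lemma measurable_internal (A : I -> set Omega) : (forall i, measurable (A i)) ->
  measurable (int A : set W).
Proof. by move=> mA; apply: sub_sigma_algebra; exists A. Qed.

(** Replace [h] by layer sums over its level sets, with uniform error 2M/n. The integral of a layer
    sum is a finite combination of probabilities, for which [QE] is exactly the claim, and the
    uniform error survives the passage to the limit on both sides. *)
Lemma loeb_integral (h : I -> Omega -> R) (M : R) :
  (forall i, measurable_fun setT (h i)) -> (forall i x, `|h i x| <= M) ->
  bounded_rv (fun w : W => lim (h i (w i) @[i --> U])) /\
  \int[P]_x h i x @[i --> U] --> \int[Q]_w lim (h i (w i) @[i --> U]).
Proof.
move=> mh hM0.
wlog M0 : M hM0 / 0 < M => [wl|].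
  apply: (wl (`|M| + 1)); last by rewrite ltr_wpDl.
  by move=> i x; rewrite (le_trans (hM0 i x))// (le_trans (ler_norm _))// lerDl.
pose H (w : W) := lim (h i (w i) @[i --> U]).
have cH w : h i (w i) @[i --> U] --> H w.
  by apply: (@bounded_ultra_cvg _ _ _ _ _ M) => i; exact: hM0.
pose A n j i := [set x | j%:R < (h i x + M) * (n%:R / (M * 2))].
have mA n j i : measurable (A n j i).
  rewrite -[A n j i]setTI.
  have : measurable_fun setT (fun x => (h i x + M) * (n%:R / (M * 2))).
    by apply: measurable_funM => //; exact: measurable_funD.
  move=> /(_ measurableT `]j%:R, +oo[%classic (measurable_itv _)).
  by congr (measurable (_ `&` _)); apply/seteqP; split => x /=; rewrite in_itv/= andbT.
(* Only [n] level sets are involved, so U decides all the memberships at once. *)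
have lE n w : \forall i \near U, layer M n (fun j => w \in int (A n j)) =
    layer M n (fun j => w i \in A n j i).
  have : \forall i \near U, forall j : 'I_n, (w \in int (A n j)) = (w i \in A n j i).
    apply: filter_forall => j; have [wA|wA] := boolP (w \in int (A n j)).
      by move: (wA); rewrite inE; apply: filterS => i Ai; apply/esym/mem_set.
    by move: wA; rewrite notin_setE => /near_not; apply: filterS => i Ai; apply/esym/memNset.
  by apply: filterS => i wA; rewrite /layer; congr (_ + _ * _); apply: eq_bigr => j _; rewrite wA.
have lA n i x : (0 < n)%N ->
    `|layer M n (fun j => x \in A n j i) - h i x| <= M * 2 / n%:R.
  move=> n0; have := layer_approx M0 n0 (hM0 i x); congr (`|layer _ _ _ - _| <= _).
  by apply/funext => j; apply/idP/idP; rewrite inE.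
have HM w : `|H w| <= M.
  rewrite -(cvg_lim _ (cvg_norm (cH w)))//.
  apply: limr_le; first by apply/cvg_ex; eexists; exact: cvg_norm (cH w).
  by apply: nearW => i.
have lH n w : (0 < n)%N ->
    `|layer M n (fun j => w \in int (A n j)) - H w| <= M * 2 / n%:R.
  move=> n0; set s := layer _ _ _.
  have c : `|s - h i (w i)| @[i --> U] --> `|s - H w|.
    by apply: cvg_norm; apply: cvgB (cH w); exact: cvg_cst.
  rewrite -(cvg_lim _ c)//; apply: limr_le; first by apply/cvg_ex; eexists; exact: c.
  by near=> i; rewrite [s](_ : _ = layer M n (fun j => w i \in A n j i)); [exact: lA|near: i; exact: lE].
have mint n j : measurable (int (A n j) : set W) by exact: measurable_internal.
have cl : M * 2 / n.+1%:R @[n --> \oo] --> (0 : R).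
  by rewrite -(mulr0 (M * 2)); apply: cvgMr => //; exact: cvg_harmonic.
have bH : bounded_rv H.
  apply: (@bounded_convergence _ _ _ Q
    (fun n (w : W) => layer M n.+1 (fun j => w \in int (A n.+1 j))) H (M * 3) _ _ _).1.
  - by move=> n; exact: (Rintegral_layer Q M n.+1 (mint n.+1)).1.1.
  - move=> n w; have h1 := lH n.+1 w isT; have h2 := HM w.
    have : M * 2 / n.+1%:R <= M * 2 by rewrite ler_piMr ?mulr_ge0 ?(ltW M0)// invf_le1// ler1n.
    move: h1 h2; move: (layer _ _ _) (H w) (_ / _) => l b c.
    rewrite !ler_norml => /andP[? ?] /andP[? ?] ?; apply/andP; split; lra.
  - move=> w; apply/cvgrPdist_le => e e0.
    have /cvgrPdist_le/(_ e e0) := cl; apply: filterS => n.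
    rewrite sub0r normrN ger0_norm ?divr_ge0 ?mulr_ge0 ?(ltW M0)//.
    by rewrite distrC; exact: le_trans (lH n.+1 w isT).
split=> //; apply/cvgrPdist_le => e e0.
(* One third for each layer approximation, under [P] and under [Q], and one third for the
   convergence of the layer integrals. *)
have e30 : 0 < e / 3 by lra.
have /cvgrPdist_le/(_ _ e30)[n _ /(_ n (leqnn _))/=] := cl.
rewrite sub0r normrN ger0_norm ?divr_ge0 ?mulr_ge0 ?(ltW M0)// => ne.
have [bS SE] := Rintegral_layer Q M n.+1 (mint n.+1).
have cS : \int[P]_x layer M n.+1 (fun j => x \in A n.+1 j i) @[i --> U] -->
    \int[Q]_w layer M n.+1 (fun j => w \in int (A n.+1 j)).
  rewrite SE; under eq_fun do rewrite (Rintegral_layer P M n.+1 (fun j => mA n.+1 j _)).2.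
  apply: cvgD; first exact: cvg_cst.
  apply: cvgMr; apply: cvg_big => //; first exact: add_continuous.
  by move=> j _; rewrite QE//; exact: ulimP.
move/cvgrPdist_le/(_ _ e30) : cS; apply: filterS => i Si.
have bi : bounded_rv (h i) by split=> //; exists M.
have bs := (Rintegral_layer P M n.+1 (fun j => mA n.+1 j i)).1.
have h1 := le_dist_Rintegral Q bS bH (fun w => lH n.+1 w isT).
have h2 := le_dist_Rintegral P bs bi (fun x => lA n.+1 i x isT).
move: (le_trans h1 ne) (le_trans h2 ne) Si.
by rewrite !ler_norml => /andP[? ?] /andP[? ?] /andP[? ?]; apply/andP; split; lra.
Unshelve. all: by end_near. Qed.

End LoebIntegral.

(** * Bernstein polynomials in several variables *)

Section Bernstein.
Context {R : realType}.
Implicit Types (s a : R) (phi psi : nat -> R).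

(* [bern N s phi] is the mean of [phi] under the binomial law with N trials
   and success probability s, i.e. the Bernstein polynomial of [phi] at s. *)
Fixpoint bern (N : nat) (s : R) (phi : nat -> R) : R :=
  if N is N'.+1 then s * bern N' s (fun j => phi j.+1) + (1 - s) * bern N' s phi
  else phi 0%N.

Lemma bernD N s phi psi : bern N s (fun j => phi j + psi j) = bern N s phi + bern N s psi.
Proof. by elim: N phi psi => //= N ih phi psi; rewrite !ih; ring. Qed.

Lemma bernZ N s a phi : bern N s (fun j => a * phi j) = a * bern N s phi.
Proof. by elim: N phi => //= N ih phi; rewrite !ih; ring. Qed.

Lemma eq_bern N s phi psi : (forall j, (j <= N)%N -> phi j = psi j) ->
  bern N s phi = bern N s psi.
Proof.
elim: N phi psi => [|N ih] phi psi e /=; first exact: e.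
congr (_ * _ + _ * _); apply: ih => j jN; apply: e => //.
exact: leq_trans jN (leqnSn N).
Qed.

Lemma bern_sum N s (J : Type) (r : seq J) (F : J -> nat -> R) :
  bern N s (fun j => \sum_(i <- r) F i j) = \sum_(i <- r) bern N s (F i).
Proof.
elim: r => [|i r ih].
  rewrite big_nil -[RHS](mul0r (bern N s (fun=> 0))) -bernZ; congr bern.
  by apply/funext => j; rewrite big_nil mul0r.
by rewrite big_cons -ih -bernD; congr bern; apply/funext => j; rewrite big_cons.
Qed.

Lemma bern_cst N s a : bern N s (fun=> a) = a.
Proof. by elim: N => //= N ->; ring. Qed.

Lemma bern_ge0 N s phi : 0 <= s <= 1 -> (forall j, 0 <= phi j) -> 0 <= bern N s phi.
Proof.
move=> s01; elim: N phi => [|N ih] phi phi0 /=; first exact: phi0.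
by case/andP: s01 => s0 s1; rewrite addr_ge0 ?mulr_ge0 ?ih ?subr_ge0.
Qed.

(** Squared bias plus variance of a binomial variable. The centre [a] is left free so that the
    induction can shift it. *)
Lemma bern_sqr N s a :
  bern N s (fun j => (j%:R - a) ^+ 2) = (N%:R * s - a) ^+ 2 + N%:R * s * (1 - s).
Proof.
elim: N a => [|N ih] a /=; first by ring.
rewrite ih (_ : (fun j => (j.+1%:R - a) ^+ 2) = fun j => (j%:R - (a - 1)) ^+ 2).
  by rewrite ih -natr1; ring.
by apply/funext => j; rewrite -natr1; congr (_ ^+ 2); ring.
Qed.

Definition bweight (N : nat) (s : R) (j : nat) : R := bern N s (fun i => (i == j)%:R).

Lemma bernE N s phi : bern N s phi = \sum_(j < N.+1) phi j * bweight N s j.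
Proof.
under eq_bigr do rewrite -bernZ; rewrite -bern_sum; apply: eq_bern => j jN.
rewrite (bigD1 (Ordinal (jN : (j < N.+1)%N)))//= eqxx mulr1 big1 ?addr0// => i ij.
by rewrite [_ == _](_ : _ = false) ?mulr0//; apply/negbTE; rewrite eq_sym.
Qed.

Lemma bweight_ge0 N s j : 0 <= s <= 1 -> 0 <= bweight N s j.
Proof. by move=> s01; apply: bern_ge0 => // i; rewrite ler0n. Qed.

Lemma bweight_sum N s : \sum_(j < N.+1) bweight N s j = 1.
Proof. by rewrite -(bern_cst N s 1) bernE; apply: eq_bigr => j _; rewrite mul1r. Qed.

Variables (k : nat) (f : 'rV[R]_k -> R) (M : R).
Hypotheses (cf : continuous f) (fM : forall x, `|f x| <= M).

(** The mean of [f] at a random point of the cube [-L, L]^k with independent coordinates, each a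
    rescaled binomial variable with parameters [N] and [s i]. *)
Definition mbern (N : nat) (L : R) (s : 'I_k -> R) : R :=
  \sum_(g : {ffun 'I_k -> 'I_N.+1})
    f (\row_i (L * (2 * ((g i)%:R / N%:R) - 1))) * \prod_i bweight N (s i) (g i).

Lemma mbern_weight N (s : 'I_k -> R) (F : 'I_k -> nat -> R) :
  \sum_(g : {ffun 'I_k -> 'I_N.+1}) \prod_i (F i (g i) * bweight N (s i) (g i)) =
  \prod_i bern N (s i) (F i).
Proof.
rewrite -(bigA_distr_bigA (fun i (j : 'I_N.+1) => F i j * bweight N (s i) j)).
by apply: eq_bigr => i _; rewrite bernE.
Qed.

Lemma mbern_weight1 N (s : 'I_k -> R) :
  \sum_(g : {ffun 'I_k -> 'I_N.+1}) \prod_i bweight N (s i) (g i) = 1.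
Proof.
rewrite -(bigA_distr_bigA (fun i (j : 'I_N.+1) => bweight N (s i) j)).
by rewrite big1// => i _; exact: bweight_sum.
Qed.

Lemma mbern_weight2 N (s : 'I_k -> R) (i : 'I_k) : (0 < N)%N ->
  \sum_(g : {ffun 'I_k -> 'I_N.+1})
    ((g i)%:R / N%:R - s i) ^+ 2 * \prod_j bweight N (s j) (g j) =
  s i * (1 - s i) / N%:R.
Proof.
move=> N0; have n0 : N%:R != 0 :> R by rewrite pnatr_eq0 -lt0n.
pose F j (m : nat) : R := if j == i then (m%:R / N%:R - s i) ^+ 2 else 1.
rewrite (eq_bigr (fun g : {ffun 'I_k -> 'I_N.+1} =>
    \prod_j (F j (g j) * bweight N (s j) (g j)))); last first.
  move=> g _; rewrite big_split/=; congr (_ * _).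
  by rewrite (bigD1 i)//= /F eqxx big1 ?mulr1// => j /negbTE ->.
rewrite mbern_weight (bigD1 i)//= big1 ?mulr1; last first.
  by move=> j /negbTE ji; rewrite (_ : F j = fun=> 1) ?bern_cst//; apply/funext => m; rewrite /F ji.
rewrite (_ : F i = fun m => (N%:R ^+ 2)^-1 * (m%:R - N%:R * s i) ^+ 2).
  by rewrite bernZ bern_sqr; field.
by apply/funext => m; rewrite /F eqxx; field.
Qed.

Lemma continuous_row (x : 'rV[R]_k) (e : R) : 0 < e -> exists2 dlt : R, 0 < dlt &
  forall y : 'rV[R]_k, (forall i, `|x ord0 i - y ord0 i| < dlt) -> `|f x - f y| < e.
Proof.
move=> e0; have /cvgrPdist_lt/(_ e e0)/nbhs_ballP[dl dl0 H] : f y @[y --> x] --> f x by exact: cf.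
exists dl => // y xy; apply: H; split=> // i j.
by rewrite (ord1 i); exact: xy.
Qed.

Lemma mbern_norm N L (s : 'I_k -> R) : (forall i, 0 <= s i <= 1) -> `|mbern N L s| <= M.
Proof.
move=> s01; rewrite (le_trans (ler_norm_sum _ _ _))//.
rewrite -[leRHS]mulr1 -[in leRHS](mbern_weight1 N s) mulr_sumr; apply: ler_sum => g _.
have w0 : 0 <= \prod_i bweight N (s i) (g i).
  by apply: prodr_ge0 => i _; exact: bweight_ge0.
by rewrite normrM (ger0_norm w0) ler_wpM2r.
Qed.

(** Bernstein's argument: the binomial frequencies concentrate at [s] with variance s_i (1 - s_i) /
    N, so the random point concentrates where [f] is nearly constant. *)
Lemma mbern_cvg (L : R) (s : 'I_k -> R) : (forall i, 0 <= s i <= 1) ->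
  mbern N.+1 L s @[N --> \oo] --> f (\row_i (L * (2 * s i - 1))).
Proof.
move=> s01; apply/cvgrPdist_le => e e0.
set x := \row_i _.
have e20 : 0 < e / 2 by lra.
have [dl dl0 hdl] := continuous_row x e20.
have M0 : 0 <= M by move: (fM (\row_i 0)); apply: le_trans.
(* Near [x] use continuity; away from [x] the quadratic term exceeds 2M. *)
pose C := 2 * M * (2 * L) ^+ 2 / dl ^+ 2.
have C0 : 0 <= C by rewrite /C divr_ge0 ?sqr_ge0// mulr_ge0 ?sqr_ge0// mulr_ge0.
have key N (g : {ffun 'I_k -> 'I_N.+2}) :
    `|f x - f (\row_i (L * (2 * ((g i)%:R / N.+1%:R) - 1)))| <=
    e / 2 + \sum_i C * ((g i)%:R / N.+1%:R - s i) ^+ 2.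
  have S0 i : 0 <= C * ((g i)%:R / N.+1%:R - s i) ^+ 2 by rewrite mulr_ge0 ?sqr_ge0.
  set y := \row_i _; have [h|] := pselect (forall i, `|x ord0 i - y ord0 i| < dl).
    by rewrite (le_trans (ltW (hdl y h)))// lerDl; apply: sumr_ge0.
  move=> /existsNP[i /negP]; rewrite -leNgt !mxE => hi.
  rewrite (bigD1 i)//= (le_trans (y := 2 * M))//.
    by rewrite (le_trans (ler_normB _ _))// mulr2n mulrDl !mul1r lerD.
  suff : 2 * M <= C * ((g i)%:R / N.+1%:R - s i) ^+ 2.
    move=> /le_trans; apply; rewrite addrCA lerDl addr_ge0 ?(ltW e20)//.
    by apply: sumr_ge0 => j _; exact: S0.
  have {}hi : dl ^+ 2 <= (2 * L) ^+ 2 * ((g i)%:R / N.+1%:R - s i) ^+ 2.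
    rewrite -exprMn -(real_normK (num_real (2 * L * _))) lerXn2r ?nnegrE ?(ltW dl0)//.
    rewrite -normrN (le_trans hi)//.
    by rewrite [leLHS](_ : _ = `|- (2 * L * ((g i)%:R / N.+1%:R - s i))|)//; congr `|_|; ring.
  have -> : C * ((g i)%:R / N.+1%:R - s i) ^+ 2 =
      2 * M * ((2 * L) ^+ 2 * ((g i)%:R / N.+1%:R - s i) ^+ 2 / dl ^+ 2).
    by rewrite /C; ring.
  by rewrite ler_peMr ?mulr_ge0// ler_pdivlMr ?exprn_gt0// mul1r.
have kC : C * k%:R / N.+1%:R @[N --> \oo] --> (0 : R).
  by rewrite -(mulr0 (C * k%:R)); apply: cvgMr => //; exact: cvg_harmonic.
have /cvgrPdist_le/(_ (e / 2)) := kC.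
move=> /(_ e20); apply: filterS => N; rewrite sub0r normrN.
rewrite ger0_norm => [hN|]; last by rewrite divr_ge0// mulr_ge0.
rewrite (_ : f x = \sum_(g : {ffun 'I_k -> 'I_N.+2})
    f x * \prod_i bweight N.+1 (s i) (g i)); last first.
  by rewrite -mulr_sumr mbern_weight1 mulr1.
rewrite /mbern -sumrB.
rewrite (le_trans (ler_norm_sum _ _ _))//.
apply: (@le_trans _ _ (\sum_(g : {ffun 'I_k -> 'I_N.+2})
   (e / 2 + \sum_i C * ((g i)%:R / N.+1%:R - s i) ^+ 2) *
   \prod_i bweight N.+1 (s i) (g i))).
  apply: ler_sum => g _; rewrite -mulrBl normrM.
  have w0 : 0 <= \prod_i bweight N.+1 (s i) (g i).
    by apply: prodr_ge0 => i _; exact: bweight_ge0.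
  by rewrite (ger0_norm w0) ler_wpM2r// key.
under eq_bigr do rewrite mulrDl mulr_suml.
rewrite big_split/= -mulr_sumr mbern_weight1 mulr1 exchange_big/=.
suff : \sum_(i < k) \sum_(g : {ffun 'I_k -> 'I_N.+2})
    C * ((g i)%:R / N.+1%:R - s i) ^+ 2 * \prod_j bweight N.+1 (s j) (g j) <= C * k%:R / N.+1%:R.
  by move=> h; rewrite [leRHS]splitr lerD2l (le_trans h hN).
have -> : C * k%:R / N.+1%:R = \sum_(i < k) C / N.+1%:R.
  by rewrite sumr_const card_ord -[RHS]mulr_natr mulrAC.
apply: ler_sum => i _; under eq_bigr do rewrite -mulrA.
rewrite -mulr_sumr mbern_weight2// ler_wpM2l// ler_piMl ?invr_ge0//.
by have /andP[? ?] := s01 i; rewrite mulr_ile1 ?subr_ge0//; lra.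
Qed.

End Bernstein.

(** * Trigonometric polynomials and their approximation of continuous functions *)

Section TrigPolynomials.
Context {R : realType} {k : nat}.
Implicit Types (phi psi : 'rV[R]_k -> R).

(** The phase [th] brings in the sines. Products are left out of the generators, so that integrals
    of trigonometric polynomials follow from those of cosines by linearity alone; closure under
    products is [trigM], by the product-to-sum formula. *)
Inductive trig_poly : ('rV[R]_k -> R) -> Prop :=
| trig_cos (c : 'I_k -> R) (th : R) :
    trig_poly (fun x => cos (\sum_i c i * x ord0 i + th))
| trig_lin (a b : R) phi psi : trig_poly phi -> trig_poly psi ->
    trig_poly (fun x => a * phi x + b * psi x).

Lemma eq_trig_poly phi psi : phi =1 psi -> trig_poly phi -> trig_poly psi.
Proof. by move=> /funext ->. Qed.

Lemma trig_cst (a : R) : trig_poly (cst a).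
Proof.
apply: eq_trig_poly (trig_lin a 0 (trig_cos (fun=> 0) 0) (trig_cos (fun=> 0) 0)) => x.
by rewrite mul0r addr0 big1 ?addr0 ?cos0 ?mulr1// => i _; rewrite mul0r.
Qed.

Lemma trigD phi psi : trig_poly phi -> trig_poly psi ->
  trig_poly (fun x => phi x + psi x).
Proof.
by move=> h1 h2; apply: eq_trig_poly (trig_lin 1 1 h1 h2) => x; rewrite !mul1r.
Qed.

Lemma trigM phi psi : trig_poly phi -> trig_poly psi ->
  trig_poly (fun x => phi x * psi x).
Proof.
move=> + tpsi; elim=> [c th|a b p q _ ihp _ ihq]; last first.
  by apply: eq_trig_poly (trig_lin a b ihp ihq) => x; ring.
elim: tpsi => [c' th'|a b p q _ ihp _ ihq]; last first.
  by apply: eq_trig_poly (trig_lin a b ihp ihq) => x; ring.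
apply: eq_trig_poly (trig_lin (2^-1) (2^-1)
  (trig_cos (fun i => c i + c' i) (th + th')) (trig_cos (fun i => c i - c' i) (th - th'))) => x.
set u := \sum_i c i * _ + th; set v := \sum_i c' i * _ + th'.
have -> : \sum_i (c i + c' i) * x ord0 i + (th + th') = u + v.
  by under eq_bigr do rewrite mulrDl; rewrite big_split/= addrACA.
have -> : \sum_i (c i - c' i) * x ord0 i + (th - th') = u - v.
  by under eq_bigr do rewrite mulrBl; rewrite sumrB /u /v; ring.
by rewrite cosD cosB; field.
Qed.

Lemma trig_sum (J : Type) (r : seq J) (F : J -> 'rV[R]_k -> R) :
  (forall j, trig_poly (F j)) -> trig_poly (fun x => \sum_(j <- r) F j x).
Proof.
move=> tF; elim: r => [|j r ih].
  by apply: eq_trig_poly (trig_cst 0) => x; rewrite big_nil.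
by apply: eq_trig_poly (trigD (tF j) ih) => x; rewrite big_cons.
Qed.

Lemma trig_prod (J : Type) (r : seq J) (F : J -> 'rV[R]_k -> R) :
  (forall j, trig_poly (F j)) -> trig_poly (fun x => \prod_(j <- r) F j x).
Proof.
move=> tF; elim: r => [|j r ih].
  by apply: eq_trig_poly (trig_cst 1) => x; rewrite big_nil.
by apply: eq_trig_poly (trigM (tF j) ih) => x; rewrite big_cons.
Qed.

Lemma trig_bern phi N (h : nat -> R) : trig_poly phi ->
  trig_poly (fun x => bern N (phi x) h).
Proof.
move=> tp; elim: N h => [|N ih] h /=; first exact: trig_cst.
apply: trigD; first exact: trigM.
apply: trigM => //; apply: eq_trig_poly (trig_lin 1 (-1) (trig_cst 1) tp) => x /=.
by ring.
Qed.

Lemma trig_sin (i : 'I_k) (L : R) : trig_poly (fun x => sin (x ord0 i / L)).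
Proof.
apply: eq_trig_poly (trig_cos (fun j => (j == i)%:R / L) (- (pi / 2))) => x.
rewrite (bigD1 i)//= eqxx big1 ?addr0 => [|j /negbTE ->]; last by rewrite !mul0r.
by rewrite cosBpihalf mul1r mulrC.
Qed.

(** Folds the whole line into [0, 1], where Bernstein polynomials apply. The corresponding point of
    [-L, L] is L (2 s - 1) = L sin(x_i / L), which tends to x_i as L grows. *)
Definition sin_coord (L : R) (x : 'rV[R]_k) (i : 'I_k) : R :=
  2^-1 * (1 + sin (x ord0 i / L)).

Lemma sin_coord01 L x i : 0 <= sin_coord L x i <= 1.
Proof.
rewrite /sin_coord; have := sin_max (x ord0 i / L); rewrite ler_norml => /andP[? ?].
by apply/andP; split; lra.
Qed.

Lemma trig_mbern (f : 'rV[R]_k -> R) N L : trig_poly (fun x => mbern f N L (sin_coord L x)).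
Proof.
apply: trig_sum => g; apply: trigM; first exact: trig_cst.
apply: trig_prod => i; apply: trig_bern; apply: trigM; first exact: trig_cst.
by apply: trigD; [exact: trig_cst|exact: trig_sin].
Qed.

Lemma cvg_scaled_sin (x : R) : n.+1%:R * sin (x / n.+1%:R) @[n --> \oo] --> x.
Proof.
have [->|x0] := eqVneq x 0.
  by under eq_fun do rewrite mul0r sin0 mulr0; exact: cvg_cst.
have /cvgr_dnbhsP/(_ (fun n => x / n.+1%:R)) :
    h^-1 *: (sin (h *: 1 + 0 : R) - sin 0) @[h --> (0 : R)^'] --> (1 : R).
  have [dsin sinE] := is_derive_sin (0 : R).
  by move: dsin; rewrite /derivable -/(derive (@sin R) 0 1) sinE cos0.
move=> /(_ _)/wrap[|h].
  split=> [n|]; first by rewrite mulf_neq0// invr_neq0// pnatr_eq0.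
  by rewrite -(mulr0 x); apply: cvgMr => //; exact: cvg_harmonic.
rewrite -[X in _ --> X]mulr1; apply: cvg_trans (cvgMr (a := x) h); apply: near_eq_cvg; apply: nearW => n /=.
by rewrite sin0 subr0 addr0 /GRing.scale/= mulr1; field; rewrite x0 addrC natr1 pnatr_eq0.
Qed.

Lemma row_sin_cvg (f : 'rV[R]_k -> R) (x : 'rV[R]_k) : continuous f ->
  f (\row_i (n.+1%:R * (2 * sin_coord n.+1%:R x i - 1))) @[n --> \oo] --> f x.
Proof.
move=> cf; apply/cvgrPdist_lt => e e0.
have [dl dl0 hdl] := continuous_row cf x e0.
have : \forall n \near \oo, forall i : 'I_k,
    `|x ord0 i - n.+1%:R * sin (x ord0 i / n.+1%:R)| < dl.
  by apply: filter_forall => i; have /cvgrPdist_lt := @cvg_scaled_sin (x ord0 i); exact.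
apply: filterS => n h; apply: hdl => i; rewrite mxE /sin_coord.
by rewrite [X in `|_ - _ * X|](_ : _ = sin (x ord0 i / n.+1%:R)) ?h//; field.
Qed.

End TrigPolynomials.

(** * Trigonometric integrals determine the law of a random vector *)

Section TrigDetermining.
Context {R : realType} {k : nat}
  {d : measure_display} {T : measurableType d} (P : probability T R)
  (X : 'I_k -> T -> R).
Hypothesis mX : forall i, measurable_fun setT (X i).

Lemma bounded_trig (phi : 'rV[R]_k -> R) : trig_poly phi ->
  bounded_rv (fun w => phi (\row_i X i w)).
Proof.
elim=> [c th|a b p q _ hp _ hq]; last first.
  by apply: bounded_rvD; apply: bounded_rvM => //; exact: bounded_rv_cst.
split; last by exists 1 => w; exact: cos_max.
apply: measurableT_comp; first exact: continuous_measurable_fun (@continuous_cos R).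
apply: measurable_funD => //; under eq_fun do under eq_bigr do rewrite mxE.
by apply: measurable_sum => i; exact: measurable_funM.
Qed.

Variables (f : 'rV[R]_k -> R) (M : R).
Hypotheses (cf : continuous f) (fM : forall x, `|f x| <= M).

Local Notation F L := (fun w => f (\row_i (L * (2 * sin_coord L (\row_i X i w) i - 1)))).

Lemma mbern_Rintegral_cvg (L : R) : bounded_rv (F L) /\
  \int[P]_w mbern f N.+1 L (sin_coord L (\row_i X i w)) @[N --> \oo] -->
  \int[P]_w (F L) w.
Proof.
apply: (bounded_convergence P (M := M)
  (f_ := fun N w => mbern f N.+1 L (sin_coord L (\row_i X i w)))).
- by move=> N; exact: (bounded_trig (trig_mbern f N.+1 L)).1.
- by move=> N w; apply: mbern_norm => // i; exact: sin_coord01.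
- by move=> w; apply: (mbern_cvg (M := M)) => // i; exact: sin_coord01.
Qed.

Lemma row_sin_Rintegral_cvg : bounded_rv (fun w => f (\row_i X i w)) /\
  \int[P]_w (F n.+1%:R) w @[n --> \oo] --> \int[P]_w f (\row_i X i w).
Proof.
apply: (bounded_convergence P (M := M) (f_ := fun n => (F n.+1%:R))).
- by move=> n; exact: (mbern_Rintegral_cvg _).1.1.
- by move=> n w; exact: fM.
- by move=> w; exact: row_sin_cvg.
Qed.

End TrigDetermining.

(** Equal cosine integrals give equal integrals of the Bernstein polynomials in the sine
    coordinates. Bounded convergence passes first to f(L sin(x / L)), as the degree grows, and then
    to f(x), as [L] grows. *)
Lemma trig_determining {R : realType} {k : nat}
  {d : measure_display} {T : measurableType d} (P : probability T R)
  {d' : measure_display} {T' : measurableType d'} (P' : probability T' R)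
  (X : 'I_k -> T -> R) (X' : 'I_k -> T' -> R) (f : 'rV[R]_k -> R) (M : R) :
  (forall i, measurable_fun setT (X i)) -> (forall i, measurable_fun setT (X' i)) ->
  (forall (c : 'I_k -> R) th, \int[P]_w cos (\sum_i c i * X i w + th) =
    \int[P']_w cos (\sum_i c i * X' i w + th)) ->
  continuous f -> (forall x, `|f x| <= M) ->
  \int[P]_w f (\row_i X i w) = \int[P']_w f (\row_i X' i w).
Proof.
move=> mX mX' XX' cf fM.
have trigE phi : trig_poly phi ->
    \int[P]_w phi (\row_i X i w) = \int[P']_w phi (\row_i X' i w).
  elim=> [c th|a b p q tp ihp tq ihq].
    under eq_Rintegral do under eq_bigr do rewrite mxE.
    by rewrite XX'; apply: eq_Rintegral => w _; under [in RHS]eq_bigr do rewrite mxE.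
  have bp := bounded_trig mX tp; have bq := bounded_trig mX tq.
  have bp' := bounded_trig mX' tp; have bq' := bounded_trig mX' tq.
  have bM (d0 : measure_display) (T0 : measurableType d0) (g : T0 -> R) (r : R) :
      bounded_rv g -> bounded_rv (fun w => r * g w).
    by move=> bg; apply: bounded_rvM => //; exact: bounded_rv_cst.
  rewrite !RintegralD//; try exact/bounded_rv_integrable/bM.
  by rewrite !RintegralZ_bounded// ihp ihq.
have [_ c] := row_sin_Rintegral_cvg P mX cf fM.
have [_ c'] := row_sin_Rintegral_cvg P' mX' cf fM.
suff e : (fun n => \int[P]_w f (\row_i (n.+1%:R * (2 * sin_coord n.+1%:R (\row_i X i w) i - 1)))) =
    (fun n => \int[P']_w f (\row_i (n.+1%:R * (2 * sin_coord n.+1%:R (\row_i X' i w) i - 1)))).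
  by rewrite e in c; exact: cvg_unique c c'.
apply/funext => n.
have [_ cn] := mbern_Rintegral_cvg P mX cf fM n.+1%:R.
have [_ cn'] := mbern_Rintegral_cvg P' mX' cf fM n.+1%:R.
suff e : (fun N => \int[P]_w mbern f N.+1 n.+1%:R (sin_coord n.+1%:R (\row_i X i w))) =
    (fun N => \int[P']_w mbern f N.+1 n.+1%:R (sin_coord n.+1%:R (\row_i X' i w))).
  by rewrite e in cn; exact: cvg_unique cn cn'.
by apply/funext => N; exact: trigE (trig_mbern f N.+1 n.+1%:R).
Qed.


(** * The limit field of a tight family on the Loeb space *)

Lemma measurable_tan {R : realType} : measurable_fun setT (@tan R).
Proof.
pose g n (v : R) := sin v * cos v * (cos v ^+ 2 + n.+1%:R^-1)^-1.
apply: (measurable_fun_cvg (h := g)) => [n|v _].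
  apply: continuous_measurable_fun => v.
  have cc : cos v @[v --> v] --> cos v by exact: continuous_cos.
  apply: cvgM; first by apply: cvgM => //; exact: continuous_sin.
  apply: cvgV; first by rewrite gt_eqF// ltr_wpDl ?sqr_ge0.
  by apply: cvgD; [rewrite expr2; exact: cvgM|exact: cvg_cst].
(* At a pole the inverse of 0 is 0 by convention, so [tan v] is 0, as is every approximant. *)
rewrite /g /tan; have [cv0|cv0] := eqVneq (cos v) 0.
  by under eq_fun do rewrite cv0 mulr0 mul0r; rewrite cv0 invr0 mulr0; exact: cvg_cst.
have -> : sin v / cos v = sin v * cos v * (cos v ^+ 2 + 0)^-1 by rewrite addr0; field.
apply: cvgM; first exact: cvg_cst.
apply: cvgV; first by rewrite addr0 sqrf_eq0.
by apply: cvgD; [exact: cvg_cst|exact: cvg_harmonic].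
Qed.

Section LoebField.
Context {R : realType} {I : Type} {U : set_system I} {uU : UltraFilter U}
  {d : measure_display} {Omega : measurableType d} (P : probability Omega R).
Local Notation W := (g_sigma_algebraType (@measurable _ (ultrapower uU Omega))).
Local Notation int := (@internal I U uU d Omega).
Variable Q : probability W R.
Hypothesis QE : forall A, (forall i, measurable (A i)) ->
  Q (int A) = (lim (fine (P (A i)) @[i --> U]))%:E.
Variables (E : Type) (Y : I -> E -> Omega -> R).
Hypotheses (mY : forall i u, measurable_fun setT (Y i u))
  (tight : forall u (e : R), 0 < e ->
    exists K : R, \forall i \near U, fine (P [set x | K < `|Y i u x|]) <= e).

Let atan_bound (x : R) : `|atan x| <= pi / 2.
Proof. by rewrite ler_norml !ltW ?atan_gtNpi2 ?atan_ltpi2. Qed.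

Let V u (w : W) : R := lim (atan (Y i u (w i)) @[i --> U]).

Let V_cvg u w : atan (Y i u (w i)) @[i --> U] --> V u w.
Proof. by apply: (@bounded_ultra_cvg _ _ _ _ _ (pi / 2)) => i; exact: atan_bound. Qed.

Let bounded_V u : bounded_rv (V u).
Proof.
apply: (loeb_integral QE (M := pi / 2) (h := fun i x => atan (Y i u x)) _ _).1 => //.
by move=> i; apply: measurableT_comp => //; apply: continuous_measurable_fun => x; exact: continuous_atan.
Qed.

(** Passing through [atan] makes the coordinates bounded, so that the ultralimit [V] exists for
    every [w] and is measurable by [loeb_integral]; [tan] undoes this wherever |V| < pi / 2. *)
Definition loeb_field u (w : W) : R := tan (V u w).

Lemma measurable_loeb_field u : measurable_fun setT (loeb_field u).
Proof. by apply: measurableT_comp; [exact: measurable_tan|exact: (bounded_V u).1]. Qed.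

(** Convergence can fail only where |V| reaches pi / 2, that is, where |Y| escapes to infinity along
    U. Tightness bounds the [Q]-measure of this set by every positive number. *)
Lemma loeb_field_cvg u : {ae Q, forall w : W, Y i u (w i) @[i --> U] --> loeb_field u w}.
Proof.
pose N := [set w : W | pi / 2 <= `|V u w|].
have mN : measurable N.
  have : measurable_fun setT (fun w => `|V u w|).
    by apply: measurableT_comp => //; exact: (bounded_V u).1.
  move=> /(_ measurableT `[pi / 2, +oo[%classic (measurable_itv _)).
  by rewrite setTI; congr measurable; apply/seteqP; split => x /=; rewrite in_itv/= andbT.
exists N; split => //.
  apply/eqP; rewrite eq_le measure_ge0 andbT; apply/lee_addgt0Pr => e e0.
  have [K PK] := tight u e0; rewrite add0e.
  have mA i : measurable [set x | K < `|Y i u x|].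
    have : measurable_fun setT (fun x => `|Y i u x|) by exact: measurableT_comp.
    move=> /(_ measurableT `]K, +oo[%classic (measurable_itv _)).
    by rewrite setTI; congr measurable; apply/seteqP; split => x /=; rewrite in_itv/= andbT.
  apply: (@le_trans _ _ (Q (int (fun i => [set x | K < `|Y i u x|])))).
    apply: le_measure; rewrite ?inE//; first exact: measurable_internal.
    (* Outside the internal set, |Y| <= K for U-almost all coordinates, hence |V| <= atan K < pi /
       2. *)
    move=> w Nw; rewrite -[int _]setCK internalC => nw.
    suff : `|V u w| <= atan K by rewrite leNgt (lt_le_trans (atan_ltpi2 K) Nw).
    have c : `|atan (Y i u (w i))| @[i --> U] --> `|V u w|.
      by apply: cvg_norm; exact: V_cvg.
    rewrite -(cvg_lim _ c)//; apply: limr_le; first by apply/cvg_ex; eexists; exact: c.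
    move: nw; apply: filterS => i /negP; rewrite -leNgt ler_norml => /andP[KY YK].
    by rewrite ler_norml -atanN !le_atan.
  rewrite QE// lee_fin; apply: limr_le => //.
  by apply/cvg_ex; eexists; exact: ulimP.
move=> w /= h; apply: contrapT => Nw; apply: h.
have {}Nw : `|V u w| < pi / 2 by rewrite ltNge; exact/negP.
rewrite (_ : (fun i => Y i u (w i)) = tan \o (fun i => atan (Y i u (w i)))); last first.
  by apply/funext => i /=; rewrite atanK.
apply: (@cvg_comp _ _ _ _ _ _ (nbhs (V u w))); [exact: V_cvg|apply: continuous_tan].
by rewrite gt_eqF// cos_gt0_pihalf// -ltr_norml.
Qed.

(** [loeb_integral] gives convergence to the integral of the ultralimit of f(Y), and by continuity
    of [f] that ultralimit is almost surely [f] of the limit field. *)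
Lemma loeb_field_expectation (k : nat) (u : 'I_k -> E) (f : 'rV[R]_k -> R) (M : R) :
  continuous f -> (forall x, `|f x| <= M) ->
  \int[P]_x f (\row_j Y i (u j) x) @[i --> U] -->
  \int[Q]_w f (\row_j loeb_field (u j) w).
Proof.
move=> cf fM.
have mf i : measurable_fun setT (fun x => f (\row_j Y i (u j) x)).
  exact: (row_sin_Rintegral_cvg P (fun j => mY i (u j)) cf fM).1.1.
have [bH cH] := @loeb_integral _ _ _ _ _ _ P Q QE (fun i x => f (\row_j Y i (u j) x)) M
  mf (fun _ _ => fM _).
rewrite [X in _ --> X](_ : _ =
  \int[Q]_w lim (f (\row_j Y i (u j) (w i)) @[i --> U]))//.
congr fine; apply: ae_eq_integral => //.
- apply/measurable_EFinP; exact: (row_sin_Rintegral_cvg Q (fun j => measurable_loeb_field (u j)) cf fM).1.1.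
- by apply/measurable_EFinP; exact: bH.1.
have : {ae Q, forall w : W, forall j : 'I_k, Y i (u j) (w i) @[i --> U] --> loeb_field (u j) w}.
  by apply: filter_forall => j; exact: loeb_field_cvg.
apply: filterS => w cw _; congr EFin; apply/esym/cvg_lim => //.
apply/cvgrPdist_lt => e e0.
have [dl dl0 hdl] := continuous_row cf (\row_j loeb_field (u j) w) e0.
have : \forall i \near U, forall j : 'I_k, `|loeb_field (u j) w - Y i (u j) (w i)| < dl.
  by apply: filter_forall => j; have /cvgrPdist_lt := cw j; exact.
by apply: filterS => i h; apply: hdl => j; rewrite !mxE.
Qed.

End LoebField.

(** * Equality of laws on the line *)

Section SameLaw.
Context {R : realType}
  {d : measure_display} {T : measurableType d} (P : probability T R)
  {d' : measure_display} {T' : measurableType d'} (P' : probability T' R).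

Definition same_law (X : T -> R) (X' : T' -> R) :=
  forall A : set R, measurable A -> P (X @^-1` A) = P' (X' @^-1` A).

Variables (X : T -> R) (X' : T' -> R).
Hypotheses (mX : measurable_fun setT X) (mX' : measurable_fun setT X').

Lemma same_law_integral (f : R -> \bar R) : same_law X X' -> measurable_fun setT f ->
  (\int[P]_w f (X w) = \int[P']_w f (X' w))%E.
Proof.
move=> XX' mf.
have ge0 (g : R -> \bar R) : measurable_fun setT g -> (forall x, 0 <= g x)%E ->
    (\int[P]_w g (X w) = \int[P']_w g (X' w))%E.
  move=> mg g0.
  have := @ge0_integral_pushforward _ _ _ _ _ X mX P setT g measurableT mg (fun x _ => g0 x).
  have := @ge0_integral_pushforward _ _ _ _ _ X' mX' P' setT g measurableT mg (fun x _ => g0 x).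
  rewrite !preimage_setT => <- <-.
  by apply: eq_measure_integral => A mA _; exact: XX'.
rewrite integralE [RHS]integralE; congr (_ - _)%E.
- rewrite (eq_integral (fun w => f^\+ (X w))%E) => [|w _]; last by rewrite !funeposE.
  rewrite [RHS](eq_integral (fun w => f^\+ (X' w))%E) => [|w _]; last by rewrite !funeposE.
  by apply: (ge0 f^\+%E); [exact: measurable_funepos|move=> x; exact: funepos_ge0].
- rewrite (eq_integral (fun w => f^\- (X w))%E) => [|w _]; last by rewrite !funenegE.
  rewrite [RHS](eq_integral (fun w => f^\- (X' w))%E) => [|w _]; last by rewrite !funenegE.
  by apply: (ge0 f^\-%E); [exact: measurable_funeneg|move=> x; exact: funeneg_ge0].
Qed.

Lemma same_law_Rintegral (f : R -> R) : same_law X X' -> measurable_fun setT f ->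
  \int[P]_w f (X w) = \int[P']_w f (X' w).
Proof.
by move=> XX' mf; congr fine; apply: (same_law_integral (f := EFin \o f)) => //; exact/measurable_EFinP.
Qed.

(** Closed rays are stable under intersection and generate the Borel sets, so uniqueness of measures
    applies. *)
Lemma same_law_rays :
  (forall a, P (X @^-1` `[a, +oo[%classic) = P' (X' @^-1` `[a, +oo[%classic)) ->
  same_law X X'.
Proof.
move=> rays A mA.
pose pX : {mfun T >-> R} := HB.pack X (isMeasurableFun.Build _ _ _ _ X mX).
pose pX' : {mfun T' >-> R} := HB.pack X' (isMeasurableFun.Build _ _ _ _ X' mX').
pose G := [set B : set R | exists a, B = `[a, +oo[%classic].
pose m1 : {measure set R -> \bar R} := distribution P pX.
pose m2 : {measure set R -> \bar R} := distribution P' pX'.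
have fm1 k : (m1 `[(- k%:R)%R, +oo[%classic < +oo)%E.
  by rewrite (le_lt_trans (probability_le1 P _))// ?ltry// -[X in measurable X]setTI; exact: mX.
apply: (@measure_unique _ R _ G (fun n => `[- n%:R, +oo[%classic) _ _ _ _ m1 m2 _ fm1 _ mA).
- exact: RGenCInfty.measurableE.
- move=> _ _ [a ->] [b ->]; exists (Num.max a b).
  by apply/seteqP; split => x /=; rewrite !in_itv/= !andbT ge_max => /andP.
- by move=> n; exists (- n%:R).
- apply/seteqP; split => // x _; exists (Num.truncn `|x|).+1 => //=.
  by rewrite in_itv/= andbT lerNl (le_trans (ler_norm _))// normrN ltW// truncnS_gt.
- by move=> _ [a ->]; exact: rays.
Qed.

(* The continuous functions [g] approximate the indicator of a closed ray from above. *)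
Lemma same_law_continuous :
  (forall g : R -> R, continuous g -> (forall x, `|g x| <= 1) ->
    \int[P]_w g (X w) = \int[P']_w g (X' w)) -> same_law X X'.
Proof.
move=> XX'; apply: same_law_rays => a.
pose g (n : nat) (x : R) := Num.max 0 (Num.min 1 (1 + n%:R * (x - a))).
have cg n : continuous (g n).
  have cl : continuous (fun x : R => 1 + n%:R * (x - a)).
    move=> x; apply: cvgD; first exact: cvg_cst.
    by apply: cvgMr => //; apply: cvgB => //; exact: cvg_cst.
  move=> x; apply: (@continuous_max _ _ (cst 0) (cst 1 \min (fun x => 1 + n%:R * (x - a)))).
    exact: cst_continuous.
  apply: (@continuous_min _ _ (cst 1) (fun x => 1 + n%:R * (x - a))); last exact: cl.
  exact: cst_continuous.
have g1 n x : `|g n x| <= 1.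
  by rewrite ger0_norm ?le_max ?lexx// ge_max ler01 ge_min lexx.
have gcvg x : g n x @[n --> \oo] --> (\1_(`[a, +oo[%classic) x : R).
  rewrite indicE; have [ax|xa] := leP a x.
    rewrite mem_set/=; last by rewrite in_itv/= ax.
    apply: cvg_near_cst; apply: nearW => n; rewrite /g min_l ?max_r//.
    by rewrite lerDl mulr_ge0// subr_ge0.
  rewrite memNset/=; last by rewrite in_itv/= andbT leNgt xa.
  apply: cvg_near_cst; near=> n; rewrite /g max_l// ge_min; apply/orP; right.
  have : (a - x)^-1 <= n%:R by near: n; exact: nbhs_infty_ger.
  by rewrite -[leLHS]mul1r ler_pdivrMr ?subr_gt0// -(opprB a x) mulrN subr_le0.
have key d0 (T0 : measurableType d0) (P0 : probability T0 R) (Z : T0 -> R) :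
    measurable_fun setT Z ->
    \int[P0]_w g n (Z w) @[n --> \oo] --> fine (P0 (Z @^-1` `[a, +oo[%classic)).
  move=> mZ.
  have mr : measurable (Z @^-1` `[a, +oo[%classic) by rewrite -[X in measurable X]setTI; exact: mZ.
  have -> : fine (P0 (Z @^-1` `[a, +oo[%classic)) =
      \int[P0]_w \1_(`[a, +oo[%classic) (Z w).
    by rewrite /Rintegral (integral_indic _ _ mr)//= ?setIT.
  apply: (bounded_convergence P0 (M := 1) (f_ := fun n w => g n (Z w)) _ _ _).2 => //.
  by move=> n; apply: measurableT_comp => //; exact: continuous_measurable_fun.
have mr : measurable (X @^-1` `[a, +oo[%classic) by rewrite -[X in measurable X]setTI; exact: mX.
have mr' : measurable (X' @^-1` `[a, +oo[%classic) by rewrite -[X in measurable X]setTI; exact: mX'.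
rewrite -[LHS]fineK ?fin_num_measure// -[RHS]fineK ?fin_num_measure//; congr EFin.
have c := key _ _ P X mX; have c' := key _ _ P' X' mX'.
suff e : (fun n => \int[P]_w g n (X w)) = (fun n => \int[P']_w g n (X' w)).
  by rewrite e in c; exact: cvg_unique c c'.
by apply/funext => n; exact: XX'.
Unshelve. all: by end_near. Qed.

End SameLaw.

(** * Gaussian laws as affine images of the standard normal law *)

Section GaussianLaw.
Context {R : realType}.
Local Notation gamma := (@normal_prob R 0 1).

Lemma normal_pdf_affine (m s y : R) : s != 0 ->
  normal_pdf m s (m + `|s| * y) * `|s| = normal_pdf 0 1 y.
Proof.
move=> s0; rewrite !normal_pdfE ?oner_neq0// /normal_peak /normal_fun.
rewrite subr0 addrAC subrr add0r exprMn real_normK ?num_real// expr1n mul1r.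
have -> : Num.sqrt (s ^+ 2 * pi *+ 2) = `|s| * Num.sqrt (pi *+ 2).
  by rewrite -mulrnAr sqrtrM ?sqr_ge0// sqrtr_sqr.
have -> : - (s ^+ 2 * y ^+ 2) / (s ^+ 2 *+ 2) = - y ^+ 2 / (1 *+ 2).
  by rewrite -mulr_natr; field.
by field; rewrite normr_eq0 s0 /= gt_eqF// sqrtr_gt0 mulrn_wgt0// pi_gt0.
Qed.

Lemma normal_prob_ray (m s a : R) : s != 0 ->
  normal_prob m s `[a, +oo[%classic = gamma `[(a - m) / `|s|, +oo[%classic.
Proof.
move=> s0; have s0' : 0 < `|s| by rewrite normr_gt0.
pose F (y : R) := m + `|s| * y; set b := (a - m) / _.
have Fb : F b = a by rewrite /F /b; field; rewrite gt_eqF.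
have dF (y : R) : is_derive y 1 F `|s|.
  by rewrite /F; apply: is_derive_eq; rewrite add0r mul1r /GRing.scale/= mulr1.
have F'E : F^`()%classic = cst `|s|.
  by apply/funext => y; rewrite derive1E derive_val.
rewrite /normal_prob -{1}Fb (@increasing_ge0_integration_by_substitutiony _ F).
- apply: eq_integral => y _; congr EFin.
  by rewrite F'E; exact: normal_pdf_affine.
- by move=> x y _ _ xy; rewrite /F ltrD2l ltr_pM2l.
- by rewrite F'E => x _; exact: cst_continuous.
- by rewrite F'E; exact: is_cvg_cst.
- by rewrite F'E; exact: is_cvg_cst.
- split; first by move=> x _; exact: ex_derive.
  by apply: cvg_at_right_filter; apply: differentiable_continuous; exact/derivable1_diffP.
- rewrite (_ : F = (fun y => y + m) \o (fun y => `|s| * y)); last first.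
    by apply/funext => y; rewrite /F /= addrC.
  apply: (@cvg_comp _ _ _ (fun y => `|s| * y) (fun y => y + m) _ (pinfty_nbhs R)).
    by apply: (gt0_cvgMry s0'); exact: cvg_id.
  exact: cvg_addrr.
- by apply: continuous_subspaceT; exact: continuous_normal_pdf.
- by move=> x _; exact: normal_pdf_ge0.
Qed.

(** Treats the Dirac case [s = 0] together with the others; the absolute value is there because [s]
    may be negative. Realizing all Gaussian laws over one space turns convergence of parameters into
    pointwise convergence. *)
Lemma gaussian_lawE (m s : R) (A : set R) : measurable A ->
  gaussian_law m s A = gamma ((fun y => m + `|s| * y) @^-1` A).
Proof.
rewrite /gaussian_law; have [->|s0] := eqVneq s 0.
  move=> mA; rewrite normr0 diracE; have [mA'|mA'] := boolP (m \in A).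
    rewrite (_ : _ @^-1` A = setT) ?probability_setT//.
    by apply/seteqP; split => // y _ /=; rewrite mul0r addr0; exact/set_mem.
  rewrite (_ : _ @^-1` A = set0) ?measure0//.
  by apply/seteqP; split => // y /=; rewrite mul0r addr0 => /mem_set; rewrite (negbTE mA').
move: A; apply: (same_law_rays (P := normal_prob m s) (X := id)) => // [|a].
  by apply: measurable_funD => //; exact: measurable_funM.
rewrite preimage_id; apply: eq_trans (normal_prob_ray m a s0) _; congr normal_prob.
apply/seteqP; split => y /=; rewrite !in_itv/= !andbT ler_pdivrMr ?normr_gt0//.
  by rewrite lerBlDl mulrC.
by rewrite -lerBlDl mulrC.
Qed.

Lemma gaussian_symmetric : same_law gamma gamma id (fun y => - y).
Proof.
apply: same_law_rays => [//||a].
  exact: oppr_measurable.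
transitivity (gamma `]-oo, - a]%classic); last first.
  congr normal_prob; apply/seteqP; split => y /=; rewrite !in_itv/= andbT.
    by rewrite lerNr.
  by rewrite lerNr.
rewrite [LHS](_ : _ = gamma `[a, +oo[%classic)// /normal_prob.
rewrite ge0_integration_by_substitutionNy.
- apply: eq_integral => y _; congr EFin.
  by rewrite /= !normal_pdfE ?oner_neq0// /normal_fun !subr0 sqrrN.
- by apply: continuous_subspaceT; apply: continuous_normal_pdf; exact: oner_neq0.
- by move=> x _; exact: normal_pdf_ge0.
Qed.

End GaussianLaw.

(** * Moments of the standard normal law *)

Section GaussianMoments.
Context {R : realType}.
Local Notation gamma := (@normal_prob R 0 1).

(** Carried as an abstract constant: the arguments use only that it is finite and positive, which
    [gaussian_square_integrableP] reads off from a Gaussian variable of mean 0 and second moment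
    1. *)
Definition gaussian_variance : R := \int[gamma]_y (y ^+ 2).

Definition gaussian_square_integrable :=
  gamma.-integrable setT (fun y : R => (y ^+ 2)%:E).

Lemma measurable_affine (m s : R) : measurable_fun setT (fun y : R => m + s * y).
Proof. by apply: measurable_funD => //; exact: measurable_funM. Qed.

Lemma integral_gaussian_cst (r : R) : (\int[gamma]_y r%:E = r%:E)%E.
Proof.
rewrite integral_cst// [X in (_ * X)%E](_ : _ = 1%E) ?mule1//.
exact: (probability_setT gamma).
Qed.

Section Moments.
Hypothesis i2 : gaussian_square_integrable.

Lemma gaussian_integrable : gamma.-integrable setT (fun y : R => y%:E).
Proof.
have := integrableD measurableT (bounded_rv_integrable gamma (bounded_rv_cst 1)) i2.
apply: le_integrable => //; first exact/measurable_EFinP.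
move=> y _; rewrite /= lee_fin [leRHS]ger0_norm ?addr_ge0 ?sqr_ge0//.
rewrite -[y ^+ 2]real_normK ?num_real//; have := normr_ge0 y.
by move: `|y| => z z0; rewrite -subr_ge0; nra.
Qed.

(** By symmetry the mean equals its opposite, and it is finite. *)
Lemma gaussian_mean0 : (\int[gamma]_y y%:E = 0)%E.
Proof.
have e : (\int[gamma]_y y%:E = \int[gamma]_y (- y)%:E)%E.
  apply: (@same_law_integral _ _ _ gamma _ _ gamma id (fun y => - y) _ _ EFin) => //.
  - exact: oppr_measurable.
  - exact: gaussian_symmetric.
have fi := integrable_fin_num measurableT gaussian_integrable.
move: e; rewrite (_ : (\int[gamma]_y (- y)%:E = - \int[gamma]_y y%:E)%E); last first.
  rewrite -mulN1e -integralZl//; last exact: gaussian_integrable.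
  by apply: eq_integral => y _; rewrite mulN1e EFinN.
rewrite -(fineK fi) -EFinN => -[] /eqP; rewrite -subr_eq0 opprK -mulr2n mulrn_eq0/=.
by move=> /eqP ->.
Qed.

Lemma integrable_affine (m s : R) : gamma.-integrable setT (fun y => (m + s * y)%:E).
Proof.
exact: (integrableD measurableT (bounded_rv_integrable gamma (bounded_rv_cst m))
  (integrableZl measurableT s gaussian_integrable)).
Qed.

Lemma gaussian_affine_mean (m s : R) : (\int[gamma]_y (m + s * y)%:E = m%:E)%E.
Proof.
rewrite (_ : (fun y : R => (m + s * y)%:E) = (fun=> m%:E) \+ (fun y : R => s%:E * y%:E))%E//.
rewrite integralD//=; last 2 first.
- exact: (bounded_rv_integrable gamma (bounded_rv_cst m)).
- exact: integrableZl gaussian_integrable.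
rewrite integralZl//; last exact: gaussian_integrable.
by rewrite gaussian_mean0 mule0 adde0 integral_gaussian_cst.
Qed.

Lemma gaussian_affine_square (m s : R) :
  (\int[gamma]_y ((m + s * y) ^+ 2)%:E = (m ^+ 2 + s ^+ 2 * gaussian_variance)%:E)%E.
Proof.
rewrite (_ : (fun y : R => ((m + s * y) ^+ 2)%:E) =
  (fun y => (m ^+ 2 + (2 * m * s) * y)%:E) \+ (fun y : R => (s ^+ 2)%:E * (y ^+ 2)%:E))%E; last first.
  by apply/funext => y /=; rewrite -EFinM -EFinD; congr EFin; ring.
rewrite integralD//=; last 2 first.
- exact: integrable_affine.
- exact: integrableZl i2.
rewrite gaussian_affine_mean integralZl// EFinD; congr (_ + _)%E.
by rewrite [RHS]EFinM fineK//; exact: integrable_fin_num i2.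
Qed.

End Moments.

Context {d : measure_display} {T : measurableType d} (P : probability T R).

Lemma gaussian_law_same_law (W : T -> R) (m s : R) : measurable_fun setT W ->
  (forall A : set R, measurable A -> P (W @^-1` A) = gaussian_law m s A) ->
  same_law P gamma W (fun y => m + `|s| * y).
Proof. by move=> mW law A mA; rewrite law// gaussian_lawE. Qed.

Lemma same_law_mean_square (W : T -> R) (m s : R) : measurable_fun setT W ->
  same_law P gamma W (fun y => m + s * y) ->
  'E_P[W]%E = (\int[gamma]_y (m + s * y)%:E)%E /\
  'E_P[fun w => (W w ^+ 2)%R]%E = (\int[gamma]_y ((m + s * y) ^+ 2)%:E)%E.
Proof.
move=> mW law; rewrite !expectation.unlock; split.
  exact: (@same_law_integral _ _ _ P _ _ gamma W _ mW (measurable_affine m s) EFin law).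
apply: (@same_law_integral _ _ _ P _ _ gamma W _ mW (measurable_affine m s) (fun x => (x ^+ 2)%:E) law).
by apply/measurable_EFinP; exact: measurable_funX.
Qed.

(** [W] has the law of m + |s| y. If [s] vanished, mean 0 would force [W] to be null, against the
    second moment 1. Hence y is an affine function of a square-integrable variable, and 1 = s^2
    times the variance of y. *)
Lemma gaussian_square_integrableP (W : T -> R) (m s : R) : measurable_fun setT W ->
  (forall A : set R, measurable A -> P (W @^-1` A) = gaussian_law m s A) ->
  'E_P[W]%E = 0%E -> 'E_P[fun w => (W w ^+ 2)%R]%E = 1%E ->
  gaussian_square_integrable /\ 0 < gaussian_variance.
Proof.
move=> mW law E0 E1.
have [] := same_law_mean_square mW (gaussian_law_same_law mW law).
rewrite {}E0 {}E1 => E0 E1.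
have s0 : `|s| != 0.
  apply/negP => /eqP s0; move: E0 E1; rewrite s0.
  under eq_integral do rewrite mul0r addr0.
  rewrite integral_gaussian_cst => -[<-].
  under eq_integral do rewrite mul0r addr0 expr0n/=.
  by rewrite integral0 => -[] /eqP; rewrite oner_eq0.
have i2 : gaussian_square_integrable.
  have im : gamma.-integrable setT (fun y => ((m + `|s| * y) ^+ 2)%:E).
    apply/integrableP; split.
      by apply/measurable_EFinP; apply: measurable_funX; exact: measurable_affine.
    under eq_integral do rewrite gee0_abs ?lee_fin ?sqr_ge0//.
    by rewrite -E1 ltry.
  have ic := bounded_rv_integrable gamma (bounded_rv_cst (m ^+ 2)).
  have := integrableZl measurableT (2 / `|s| ^+ 2) (integrableD measurableT im ic).
  apply: le_integrable => //; first by apply/measurable_EFinP; exact: measurable_funX.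
  move=> y _ /=; rewrite lee_fin [leLHS]ger0_norm ?sqr_ge0//.
  rewrite ger0_norm; last by rewrite mulr_ge0 ?addr_ge0 ?sqr_ge0// divr_ge0 ?sqr_ge0.
  rewrite mulrAC ler_pdivlMr; last by rewrite exprn_gt0// lt_def s0 normr_ge0.
  (* The gap in s^2 y^2 <= 2 ((m + |s| y)^2 + m^2) is a perfect square. *)
  by rewrite -subr_ge0 [leRHS](_ : _ = (2 * m + `|s| * y) ^+ 2) ?sqr_ge0//; ring.
split=> //.
move: E0 E1; rewrite gaussian_affine_mean// gaussian_affine_square// => -[<-] -[].
rewrite expr0n add0r => e1.
have : 0 <= gaussian_variance by apply: Rintegral_ge0 => y _; exact: sqr_ge0.
rewrite le_eqVlt => /predU1P[k0|//]; move/eqP: e1.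
by rewrite -k0 mulr0 oner_eq0.
Qed.

Hypotheses (i2 : gaussian_square_integrable) (kappa0 : 0 < gaussian_variance).

(** The first two moments of m + |s| y force m = 0 and s^2 = v / [gaussian_variance]. *)
Lemma centered_gaussian_same_law (W : T -> R) (m s v : R) : measurable_fun setT W ->
  (forall A : set R, measurable A -> P (W @^-1` A) = gaussian_law m s A) ->
  'E_P[W]%E = 0%E -> 'E_P[fun w => (W w ^+ 2)%R]%E = v%:E ->
  same_law P gamma W (fun y => Num.sqrt (v / gaussian_variance) * y).
Proof.
move=> mW law E0 Ev; have sl := gaussian_law_same_law mW law.
have [] := same_law_mean_square mW sl.
rewrite {}E0 {}Ev gaussian_affine_mean// gaussian_affine_square// => -[m0] -[vE].
move: sl; rewrite vE -m0 expr0n add0r mulfK ?gt_eqF//= real_normK ?num_real// sqrtr_sqr.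
by congr same_law; apply/funext => y; rewrite add0r.
Qed.

Lemma same_law_gaussian (W : T -> R) (v : R) : measurable_fun setT W -> 0 <= v ->
  same_law P gamma W (fun y => Num.sqrt (v / gaussian_variance) * y) ->
  [/\ forall A : set R, measurable A ->
        P (W @^-1` A) = gaussian_law 0 (Num.sqrt (v / gaussian_variance)) A,
      'E_P[W]%E = 0%E & 'E_P[fun w => (W w ^+ 2)%R]%E = v%:E].
Proof.
move=> mW v0 law; set s := Num.sqrt _ in law *.
have law0 : same_law P gamma W (fun y => 0 + s * y).
  by rewrite (_ : (fun y => 0 + s * y) = (fun y => s * y))//; apply/funext => y; rewrite add0r.
split.
- by move=> A mA; rewrite law0// gaussian_lawE// ger0_norm// sqrtr_ge0.
- by have [-> _] := same_law_mean_square mW law0; rewrite gaussian_affine_mean.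
- have [_ ->] := same_law_mean_square mW law0; rewrite gaussian_affine_square//.
  by rewrite expr0n add0r sqr_sqrtr ?divr_ge0 ?(ltW kappa0)// divfK// gt_eqF.
Qed.

End GaussianMoments.

(** * Means and variances of linear combinations from a covariance function *)

Section SecondMoments.
Context {R : realType} {d : measure_display} {T : measurableType d}
  (P : probability T R) (E : Type) (X : E -> T -> R) (C : E -> E -> R).
Hypotheses (mX : forall a, measurable_fun setT (X a))
  (EX : forall a, 'E_P[X a]%E = 0%E)
  (CX : forall a b, 'E_P[fun w => (X a w * X b w)%R]%E = (C a b)%:E).

Lemma integrable_sq a : P.-integrable setT (fun w => (X a w ^+ 2)%:E).
Proof.
apply/integrableP; split; first by apply/measurable_EFinP; exact: measurable_funX.
under eq_integral do rewrite gee0_abs ?lee_fin ?sqr_ge0// expr2.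
by move: (CX a a); rewrite expectation.unlock => ->; rewrite ltry.
Qed.

Lemma integrable_mul a b : P.-integrable setT (fun w => (X a w * X b w)%:E).
Proof.
have := integrableD measurableT (integrable_sq a) (integrable_sq b).
apply: le_integrable => //; first by apply/measurable_EFinP; exact: measurable_funM.
move=> w _ /=; rewrite lee_fin [leRHS]ger0_norm ?addr_ge0 ?sqr_ge0//.
rewrite normrM -(real_normK (num_real (X a w))) -(real_normK (num_real (X b w))).
have := normr_ge0 (X a w); have := normr_ge0 (X b w).
move: `|X a w| `|X b w| => x y x0 y0; nra.
Qed.

Lemma integrable_fst a : P.-integrable setT (fun w => (X a w)%:E).
Proof.
have := integrableD measurableT (bounded_rv_integrable P (bounded_rv_cst 1)) (integrable_sq a).
apply: le_integrable => //; first exact/measurable_EFinP.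
move=> w _ /=; rewrite lee_fin [leRHS]ger0_norm ?addr_ge0 ?sqr_ge0//.
rewrite -(real_normK (num_real (X a w))); have := normr_ge0 (X a w).
by move: `|X a w| => x x0; nra.
Qed.

Lemma expectation_lin (J : Type) (r : seq J) (F : J -> T -> R) (c m : J -> R) :
  (forall j, P.-integrable setT (fun w => (F j w)%:E)) ->
  (forall j, 'E_P[F j]%E = (m j)%:E) ->
  P.-integrable setT (fun w => (\sum_(j <- r) c j * F j w)%:E) /\
  'E_P[fun w => (\sum_(j <- r) c j * F j w)%R]%E = (\sum_(j <- r) c j * m j)%:E.
Proof.
move=> iF EF; rewrite expectation.unlock.
elim: r => [|j r [ih1 ih2]].
  rewrite big_nil; under eq_integral do rewrite big_nil.
  under eq_fun do rewrite big_nil; rewrite integral0; split => //.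
  exact: integrable0.
have ij := integrableZl measurableT (c j) (iF j).
rewrite big_cons; under eq_integral do rewrite big_cons EFinD EFinM.
under eq_fun do rewrite big_cons EFinD EFinM.
split; first exact: (integrableD measurableT ij ih1).
rewrite integralD//= ih2 integralZl// EFinD EFinM.
by move: (EF j); rewrite expectation.unlock => ->.
Qed.

Lemma linear_comb_mean (k : nat) (c : 'I_k -> R) (t : 'I_k -> E) :
  'E_P[fun w => (\sum_i c i * X (t i) w)%R]%E = 0%E.
Proof.
have [_ ->] := expectation_lin (index_enum 'I_k) c (fun i => integrable_fst (t i)) (m := fun=> 0)
  (fun i => EX (t i)).
by rewrite big1// => i _; rewrite mulr0.
Qed.

Lemma linear_comb_square (k : nat) (c : 'I_k -> R) (t : 'I_k -> E) :
  'E_P[fun w => ((\sum_i c i * X (t i) w) ^+ 2)%R]%E =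
  (\sum_i \sum_j c i * c j * C (t i) (t j))%:E.
Proof.
have [_] := expectation_lin (index_enum ('I_k * 'I_k)%type) (fun p => c p.1 * c p.2)
  (fun p => integrable_mul (t p.1) (t p.2)) (fun p => CX (t p.1) (t p.2)).
rewrite pair_bigA/= => <-; congr expectation; apply/funext => w.
rewrite expr2 mulr_suml -(pair_bigA _ (fun i j => c i * c j * (X (t i) w * X (t j) w)))/=.
apply: eq_bigr => i _; rewrite mulr_sumr; apply: eq_bigr => j _; ring.
Qed.

End SecondMoments.

(** If a neighbourhood [B] of [l] were missed, [F] together with the complement of the preimage of
    [B] would generate a proper filter, and an ultrafilter above it would contradict the
    hypothesis. *)
Lemma ultra_cvg {I : Type} (F : set_system I) {FF : ProperFilter F}
    {V : topologicalType} (x : I -> V) (l : V) :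
  (forall U, UltraFilter U -> F `<=` U -> x i @[i --> U] --> l) ->
  x i @[i --> F] --> l.
Proof.
move=> H B lB; apply: contrapT => nB.
have FF' : ProperFilter (within (~` (x @^-1` B)) F).
  apply: Build_ProperFilter_ex => D FD; apply: contrapT => /forallNP nD; apply: nB.
  have {}FD : F [set i | ~ B (x i) -> D i] := FD.
  suff : F (x @^-1` B) by [].
  by apply: filterS FD => i Di; apply: contrapT => /Di; exact: nD.
have [U [uU sFU]] := ultraFilterLemma FF'.
have UB : U (x @^-1` B).
  by apply: (H U uU _ B lB) => A FA; apply: sFU; have : F [set i | ~ B (x i) -> A i] by apply: filterS FA => i Ai _.
have UnB : U (~` (x @^-1` B)) by apply: sFU; apply: nearW => i.
by have /filter_ex[i []] : U ((x @^-1` B) `&` ~` (x @^-1` B)) by exact: filterI.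
Qed.

(** * Covariance of the rescaled increments and its limit *)

Section Increments.
Context {R : realType} {n : nat}.

Lemma eucl_normZ (eps : R) (u : 'rV[R]_n) : 0 <= eps ->
  eucl_norm (eps *: u) = eps * eucl_norm u.
Proof.
move=> e0; rewrite /eucl_norm; under eq_bigr do rewrite mxE exprMn.
by rewrite -mulr_sumr sqrtrM ?sqr_ge0// sqrtr_sqr ger0_norm.
Qed.

Lemma eucl_norm0 : eucl_norm (0 : 'rV[R]_n) = 0.
Proof. by rewrite /eucl_norm big1 ?sqrtr0// => i _; rewrite mxE expr0n. Qed.

Lemma eucl_normN (u : 'rV[R]_n) : eucl_norm (- u) = eucl_norm u.
Proof. by congr Num.sqrt; apply: eq_bigr => i _; rewrite mxE sqrrN. Qed.

Variables (alpha beta : R).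
Hypothesis alpha0 : 0 < alpha.

Definition cauchy (y : R) : R := (1 + y) `^ (- beta).
Definition norm_pow (u : 'rV[R]_n) : R := eucl_norm u `^ alpha.

Lemma norm_pow_ge0 u : 0 <= norm_pow u.
Proof. exact: powR_ge0. Qed.

Lemma norm_pow0 : norm_pow 0 = 0.
Proof. by rewrite /norm_pow eucl_norm0 powR0// gt_eqF. Qed.

Lemma norm_powZ (eps : R) u : 0 <= eps -> norm_pow (eps *: u) = eps `^ alpha * norm_pow u.
Proof. by move=> e0; rewrite /norm_pow eucl_normZ// powRM ?sqrtr_ge0. Qed.

Lemma cauchy0 : cauchy 0 = 1.
Proof. by rewrite /cauchy addr0 powR1. Qed.

Lemma cauchy_slope (a : R) (x : nat -> R) : 0 <= a -> (forall m, 0 < x m) ->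
  x m @[m --> \oo] --> (0 : R) ->
  (cauchy (x m * a) - 1) / x m @[m --> \oo] --> - beta * a.
Proof.
move=> a0 x0 xc.
have [->|a_neq0] := eqVneq a 0.
  under eq_fun do rewrite mulr0 /cauchy addr0 powR1 subrr mul0r.
  by rewrite mulr0; exact: cvg_cst.
have /cvgr_dnbhsP/(_ (fun m => x m * a)) :
    h^-1 *: ((h *: 1 + 1 : R) `^ (- beta) - 1 `^ (- beta)) @[h --> (0 : R)^'] --> - beta.
  have [dp pE] := is_derive1_powR (- beta) (ltr01 : 0 < (1 : R)).
  move: dp; rewrite /derivable -/(derive (fun a : R => a `^ (- beta)) 1 1) pE.
  by rewrite powR1 mulr1.
move=> /(_ _)/wrap[|h].
  split=> [m|]; first by rewrite mulf_neq0// gt_eqF.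
  by rewrite -(mul0r a); apply: cvgMl.
apply: cvg_trans (cvgMl (b := a) h); apply: near_eq_cvg; apply: nearW => m /=.
rewrite /GRing.scale/= mulr1 powR1 /cauchy [1 + _]addrC.
by field; rewrite gt_eqF.
Qed.

Context {d : measure_display} {Omega : measurableType d} {P : probability Omega R}.
Variable (X : random_field n P).
Hypothesis hX : gfgcc alpha beta X.

Lemma gfgcc_cov (s t : 'rV[R]_n) :
  'E_P[fun w => (X s w * X t w)%R]%E = (cauchy (norm_pow (s - t)))%:E.
Proof. by have [_ _ /(_ t (s - t))] := hX; rewrite addrC subrK. Qed.

Variable t0 : 'rV[R]_n.

Definition increment (eps : R) (u : 'rV[R]_n) (w : Omega) : R :=
  eps `^ (- (alpha / 2)) * (X (t0 + eps *: u) w - X t0 w).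

Lemma measurable_increment eps u : measurable_fun setT (increment eps u).
Proof. by apply: measurable_funM => //; exact: measurable_funB. Qed.

Lemma increment_mean eps u : 'E_P[increment eps u]%E = 0%E.
Proof.
have [_ mean _] := hX.
pose r : seq (R * 'rV[R]_n) := [:: (1, t0 + eps *: u); (-1, t0)].
have iX t : P.-integrable setT (fun w => (X t w)%:E).
  exact: (integrable_fst (fun a => measurable_funP (X a)) gfgcc_cov t).
have [_] := expectation_lin r (fun p => eps `^ (- (alpha / 2)) * p.1)
  (fun p => iX p.2) (m := fun=> 0) (fun p => mean p.2).
rewrite big1 => [h|p _]; last by rewrite mulr0.
apply: eq_trans h; congr expectation; apply/funext => w.
by rewrite !big_cons big_nil /increment/=; ring.
Qed.

Definition increment_cov (eps : R) (u v : 'rV[R]_n) : R :=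
  (cauchy (eps `^ alpha * norm_pow (u - v)) - cauchy (eps `^ alpha * norm_pow u)
   - cauchy (eps `^ alpha * norm_pow v) + 1) / eps `^ alpha.

Lemma increment_covE eps u v : 0 < eps ->
  'E_P[fun w => (increment eps u w * increment eps v w)%R]%E = (increment_cov eps u v)%:E.
Proof.
move=> e0; set tu := t0 + eps *: u; set tv := t0 + eps *: v.
(* The product of two increments expands into four products of values of [X], listed with their
   signs. *)
pose r : seq (R * ('rV[R]_n * 'rV[R]_n)) :=
  [:: (1, (tu, tv)); (-1, (tu, t0)); (-1, (tv, t0)); (1, (t0, t0))].
have iX s t : P.-integrable setT (fun w => (X s w * X t w)%:E).
  exact: (integrable_mul (fun a => measurable_funP (X a)) gfgcc_cov s t).
have [_] := expectation_lin r (fun p => (eps `^ (- (alpha / 2))) ^+ 2 * p.1)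
  (fun p => iX p.2.1 p.2.2) (fun p => gfgcc_cov p.2.1 p.2.2).
rewrite (_ : (fun w => _) = (fun w => increment eps u w * increment eps v w)); last first.
  by apply/funext => w; rewrite !big_cons big_nil /increment/= -/tu -/tv; ring.
move=> ->; congr EFin; rewrite !big_cons big_nil /=.
rewrite (_ : tu - tv = eps *: (u - v)); last by rewrite scalerBr opprD addrACA subrr add0r.
rewrite (_ : tu - t0 = eps *: u); last by rewrite /tu addrAC subrr add0r.
rewrite (_ : tv - t0 = eps *: v); last by rewrite /tv addrAC subrr add0r.
rewrite subrr norm_pow0 !norm_powZ ?(ltW e0)// cauchy0.
have -> : (eps `^ (- (alpha / 2))) ^+ 2 = (eps `^ alpha)^-1.
  rewrite expr2 -powRD; last by rewrite (gt_eqF e0) implybT.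
  by rewrite -powRN; congr (_ `^ _); field.
rewrite /increment_cov; move: (cauchy _) (cauchy _) (cauchy _) (_^-1) => r1 r2 r3 x.
by ring.
Qed.

Definition limit_cov (u v : 'rV[R]_n) : R :=
  beta * (norm_pow u + norm_pow v - norm_pow (u - v)).

Lemma increment_cov_cvg (e : nat -> R) u v : (forall m, 0 < e m) ->
  e m @[m --> \oo] --> (0 : R) ->
  increment_cov (e m) u v @[m --> \oo] --> limit_cov u v.
Proof.
move=> e0 ec.
have x0 m : 0 < e m `^ alpha by exact: powR_gt0.
have xc : e m `^ alpha @[m --> \oo] --> (0 : R).
  have /cvg_at_rightP := powR_cvg0 alpha0.
  by move=> /(_ e); apply; split.
have sl a (a0 : 0 <= a) := cauchy_slope a0 x0 xc.
have -> : limit_cov u v = - beta * norm_pow (u - v) - - beta * norm_pow u - - beta * norm_pow v.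
  by rewrite /limit_cov; move: (norm_pow _) (norm_pow _) (norm_pow _) => x y z; ring.
have s1 := sl _ (norm_pow_ge0 (u - v)).
have s2 := sl _ (norm_pow_ge0 u); have s3 := sl _ (norm_pow_ge0 v).
apply: cvg_trans (cvgB (cvgB s1 s2) s3); apply: near_eq_cvg; apply: nearW => m.
(* Distributing the constant 1 turns the numerator into three difference quotients of [cauchy] at
   0. *)
have slopeE (x y z i : R) :
    (x - y - z + 1) * i = (x - 1) * i - (y - 1) * i - (z - 1) * i by ring.
by rewrite /increment_cov slopeE.
Qed.

End Increments.

(** * Limit laws and tightness of linear combinations of increments *)

Section TangentLimit.
Context {R : realType} {n : nat} (alpha beta : R).
Hypothesis alpha0 : 0 < alpha.
Context {d : measure_display} {Omega : measurableType d} {P : probability Omega R}.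
Variable (X : random_field n P).
Hypothesis hX : gfgcc alpha beta X.
Variable t0 : 'rV[R]_n.
Local Notation gamma := (@normal_prob R 0 1).
Local Notation kappa := (@gaussian_variance R).
Local Notation Y := (increment alpha X t0).

Let mY eps u : measurable_fun setT (Y eps u) := measurable_increment alpha X t0 eps u.

(** The variable [X t0] is centered Gaussian with variance [cauchy 0], that is, 1. *)
Lemma gfgcc_gaussian_variance : @gaussian_square_integrable R /\ 0 < kappa.
Proof.
have [gX cX _] := hX.
have [m [s law]] := gX 1%N (fun=> t0) (fun=> 1).
apply: (@gaussian_square_integrableP _ _ _ P (X t0) m s) => //.
- move=> A mA; rewrite -law//; congr (P (_ @^-1` A)).
  by apply/funext => w; rewrite big_ord1 mul1r.
- have := gfgcc_cov hX t0 t0; rewrite subrr norm_pow0// cauchy0 => h.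
  by apply: eq_trans h; congr expectation; apply/funext => w; rewrite expr2.
Qed.

Let i2 := gfgcc_gaussian_variance.1.
Let kappa0 := gfgcc_gaussian_variance.2.

Definition increment_var eps k (c : 'I_k -> R) (u : 'I_k -> 'rV[R]_n) : R :=
  \sum_i \sum_j c i * c j * increment_cov alpha beta eps (u i) (u j).

Definition limit_var k (c : 'I_k -> R) (u : 'I_k -> 'rV[R]_n) : R :=
  \sum_i \sum_j c i * c j * limit_cov alpha beta (u i) (u j).

Lemma increment_square eps k (c : 'I_k -> R) u : 0 < eps ->
  'E_P[fun w => ((\sum_i c i * Y eps (u i) w) ^+ 2)%R]%E = (increment_var eps c u)%:E.
Proof.
move=> e0; apply: (linear_comb_square (C := increment_cov alpha beta eps)) => // a b.
exact: increment_covE.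
Qed.

Lemma measurable_increment_comb eps k (c : 'I_k -> R) u :
  measurable_fun setT (fun w => \sum_i c i * Y eps (u i) w).
Proof. by apply: measurable_sum => i; exact: measurable_funM. Qed.

Lemma increment_same_law eps k (c : 'I_k -> R) u : 0 < eps ->
  same_law P gamma (fun w => \sum_i c i * Y eps (u i) w)
    (fun y => Num.sqrt (increment_var eps c u / kappa) * y).
Proof.
move=> e0; have [gX _ _] := hX; pose lam := eps `^ (- (alpha / 2)).
(* Index 0 is the base point [t0], which collects the weight - lam times the sum of the c_j; the
   remaining indices are the shifted points. *)
pose t (i : 'I_k.+1) := oapp (fun j => t0 + eps *: u j) t0 (unlift ord0 i).
pose b (i : 'I_k.+1) := oapp (fun j => c j * lam) (- (\sum_j c j) * lam) (unlift ord0 i).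
have [m [s law]] := gX _ t b.
apply: (@centered_gaussian_same_law _ _ _ P i2 kappa0 _ m s) => //.
- exact: measurable_increment_comb.
- move=> A mA; rewrite -law//; congr (P (_ @^-1` A)); apply/funext => w.
  rewrite big_ord_recl {1}/t {1}/b unlift_none [oapp _ _ _]/= [oapp _ _ _]/=.
  rewrite [X in _ = _ + X](eq_bigr (fun i => c i * lam * X (t0 + eps *: u i) w)); last first.
    by move=> i _; rewrite /t /b liftK.
  rewrite !mulNr !mulr_suml -sumrN -big_split/=; apply: eq_bigr => i _.
  by rewrite /increment -/lam; ring.
- apply: (linear_comb_mean (C := increment_cov alpha beta eps)) => //.
    by move=> a; exact: (increment_mean hX).
  by move=> a a'; exact: increment_covE.
- exact: increment_square.
Qed.

Section AlongSequence.
Variable e : nat -> R.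
Hypotheses (e0 : forall m, 0 < e m) (ec : e m @[m --> \oo] --> (0 : R)).

Lemma increment_var_cvg k (c : 'I_k -> R) u :
  increment_var (e m) c u @[m --> \oo] --> limit_var c u.
Proof.
apply: cvg_big => //; first exact: add_continuous.
move=> i _; apply: cvg_big => //; first exact: add_continuous.
by move=> j _; apply: cvgMr => //; exact: increment_cov_cvg.
Qed.

(** A limit of variances; this is the positive semidefiniteness of the limit covariance. *)
Lemma limit_var_ge0 k (c : 'I_k -> R) u : 0 <= limit_var c u.
Proof.
have cv : increment_var (e m) c u @[m --> \oo] --> limit_var c u.
  exact: increment_var_cvg.
rewrite -(cvg_lim _ cv)//; apply: limr_ge; first by apply/cvg_ex; eexists; exact: cv.
apply: nearW => m; rewrite -lee_fin -increment_square//.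
by apply: expectation_ge0 => w; exact: sqr_ge0.
Qed.

(** Each combination has the law of a multiple of one fixed standard normal variable. The factors
    converge, so bounded convergence under [gamma] applies. *)
Lemma increment_Rintegral_cvg k (c : 'I_k -> R) u (g : R -> R) (M : R) :
  continuous g -> (forall x, `|g x| <= M) ->
  \int[P]_w g (\sum_i c i * Y (e m) (u i) w) @[m --> \oo] -->
  \int[gamma]_y g (Num.sqrt (limit_var c u / kappa) * y).
Proof.
move=> cg gM; have mg := continuous_measurable_fun cg.
have -> : (fun m => \int[P]_w g (\sum_i c i * Y (e m) (u i) w)) =
    (fun m => \int[gamma]_y g (Num.sqrt (increment_var (e m) c u / kappa) * y)).
  apply/funext => m; apply: (same_law_Rintegral _ _ (increment_same_law c u (e0 m)) mg) => //.
  - exact: measurable_increment_comb.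
  - exact: measurable_funM.
apply: (bounded_convergence gamma (M := M) (f_ := fun m y =>
  g (Num.sqrt (increment_var (e m) c u / kappa) * y)) _ _ _).2 => //.
  by move=> m; apply: measurableT_comp => //; exact: measurable_funM.
move=> y; apply: (@cvg_comp _ _ _ _ g _ (nbhs (Num.sqrt (limit_var c u / kappa) * y))); last exact: cg.
apply: cvgMl => //; apply: (@cvg_comp _ _ _ _ Num.sqrt _ (nbhs (limit_var c u / kappa))).
  by apply: cvgMl => //; exact: increment_var_cvg.
exact: sqrt_continuous.
Qed.

(** Uniqueness of limits along [F]. The filter is arbitrary above [\oo] so that this covers both
    Loeb limits and ordinary ones. *)
Lemma limit_same_law (F : set_system nat) {FF : ProperFilter F} k (c : 'I_k -> R) u
    {d' : measure_display} {W : measurableType d'} (Q : probability W R) (S : W -> R) :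
  \oo `<=` F -> measurable_fun setT S ->
  (forall g : R -> R, continuous g -> (forall x, `|g x| <= 1) ->
    \int[P]_w g (\sum_i c i * Y (e m) (u i) w) @[m --> F] --> \int[Q]_w g (S w)) ->
  same_law Q gamma S (fun y => Num.sqrt (limit_var c u / kappa) * y).
Proof.
move=> ooF mS H; apply: same_law_continuous => //; first exact: measurable_funM.
move=> g cg g1; apply: (cvg_unique _ (H g cg g1)) => //.
apply: (@cvg_trans _ ((fun m => \int[P]_w g (\sum_i c i * Y (e m) (u i) w)) @ \oo)).
  by move=> A /ooF.
exact: increment_Rintegral_cvg cg g1.
Qed.

(** Chebyshev's inequality: the second moments converge to [q], hence are eventually at most q +
    1. *)
Lemma increment_tight u (eps : R) : 0 < eps -> exists K : R,
  \forall m \near \oo, fine (P [set x | K < `|Y (e m) u x|]) <= eps.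
Proof.
move=> eps0.
pose c (_ : 'I_1) : R := 1; pose q := limit_var c (fun=> u).
have vc : increment_var (e m) c (fun=> u) @[m --> \oo] --> q by exact: increment_var_cvg.
have q0 : 0 <= q by exact: limit_var_ge0.
have : \forall m \near \oo, increment_var (e m) c (fun=> u) <= q + 1.
  by have /cvgr_le := vc; apply; rewrite ltrDl.
(* The added 1 gives K <= K^2, so a bound on K times the probability follows from Chebyshev, and K
   eps >= q + 1 concludes. *)
pose K := (q + 1) / eps + 1.
have K1 : 1 <= K by rewrite lerDr divr_ge0 ?(ltW eps0)// addr_ge0.
have K0 : 0 < K by exact: lt_le_trans K1.
move=> vq; exists K; apply: filterS vq => m vm.
have mYu : measurable_fun setT (fun w => Y (e m) u w ^+ 2) by exact: measurable_funX.
have mA : measurable [set x | K < `|Y (e m) u x|].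
  have : measurable_fun setT (fun x => `|Y (e m) u x|) by exact: measurableT_comp.
  move=> /(_ measurableT `]K, +oo[%classic (measurable_itv _)).
  by rewrite setTI; congr measurable; apply/seteqP; split => x /=; rewrite in_itv/= andbT.
have K20 : 0 < K ^+ 2 by exact: exprn_gt0.
have mYuE : measurable_fun setT (fun w => (Y (e m) u w ^+ 2)%:E) by exact/measurable_EFinP.
have h := le_integral_abse P measurableT mYuE K20; rewrite setTI in h.
have {}h : ((K ^+ 2)%:E * P [set x | (K < `|Y (e m) u x|)%R] <= (q + 1)%:E)%E.
  apply: le_trans (le_trans h _); last first.
    under eq_integral do rewrite gee0_abs ?lee_fin ?sqr_ge0//.
    have := increment_square c (fun=> u) (e0 m).
    under [X in expectation P X]eq_fun do rewrite big_ord1 mul1r.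
    by rewrite expectation.unlock => ->; rewrite lee_fin.
  apply: lee_wpmul2l; first by rewrite lee_fin ltW.
  apply: le_measure; rewrite ?inE//.
    have := mYu measurableT `[K ^+ 2, +oo[%classic (measurable_itv _).
    rewrite setTI; congr measurable; apply/seteqP; split => x /=; rewrite in_itv/= andbT.
      by rewrite lee_fin ger0_norm ?sqr_ge0.
    by rewrite lee_fin ger0_norm ?sqr_ge0.
  move=> x /= Kx; rewrite lee_fin ger0_norm ?sqr_ge0// -(real_normK (num_real (Y _ _ _))).
  by rewrite lerXn2r ?nnegrE ?(ltW K0)// ltW.
move: h; rewrite -[P _]fineK ?fin_num_measure// -EFinM lee_fin => h.
have : K * fine (P [set x | K < `|Y (e m) u x|]) <= q + 1.
  by apply: le_trans h; rewrite ler_wpM2r ?fine_ge0// expr2 ler_peMl// ltW.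
rewrite mulrC -ler_pdivlMr// => /le_trans; apply.
rewrite ler_pdivrMr// /K mulrDr mulr1 mulrC divfK ?gt_eqF//.
by rewrite lerDl ltW.
Qed.

End AlongSequence.

End TangentLimit.

(** * Existence of the limit field *)

Section TangentField.
Context {R : realType} {n : nat} (alpha beta : R).
Hypothesis alpha0 : 0 < alpha.
Context {d : measure_display} {Omega : measurableType d} {P : probability Omega R}.
Variable (X : random_field n P).
Hypothesis hX : gfgcc alpha beta X.
Variable t0 : 'rV[R]_n.
Local Notation gamma := (@normal_prob R 0 1).
Local Notation kappa := (@gaussian_variance R).
Local Notation Y := (increment alpha X t0).

Definition increments_converge (e : nat -> R) (F : set_system nat)
    {d' : measure_display} {W : measurableType d'} (Q : probability W R)
    (T : 'rV[R]_n -> W -> R) : Prop :=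
  forall (k : nat) (u : 'I_k -> 'rV[R]_n) (f : 'rV[R]_k -> R) (M : R),
    continuous f -> (forall x, `|f x| <= M) ->
    \int[P]_w f (\row_i Y (e m) (u i) w) @[m --> F] -->
    \int[Q]_w f (\row_i T (u i) w).

(** A test function of a linear combination is a test function of the vector, so [limit_same_law]
    applies. *)
Lemma increments_converge_same_law (e : nat -> R) (F : set_system nat)
    {FF : ProperFilter F} {d' : measure_display} {W : measurableType d'}
    (Q : probability W R) (T : 'rV[R]_n -> W -> R) :
  (forall m, 0 < e m) -> e m @[m --> \oo] --> (0 : R) -> \oo `<=` F ->
  (forall u, measurable_fun setT (T u)) -> increments_converge e F Q T ->
  forall k (c : 'I_k -> R) u, same_law Q gamma (fun w => \sum_i c i * T (u i) w)
    (fun y => Num.sqrt (limit_var alpha beta c u / kappa) * y).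
Proof.
move=> e0 ec ooF mT cT k c u.
apply: (@limit_same_law _ _ _ _ alpha0 _ _ _ _ hX t0 e e0 ec F FF k c u _ _ Q
  (fun w => \sum_i c i * T (u i) w) ooF) => [|g cg g1].
  by apply: measurable_sum => i; exact: measurable_funM.
pose f (x : 'rV[R]_k) := g (\sum_i c i * x ord0 i).
have cf : continuous f.
  move=> x; apply: (@cvg_comp _ _ _ _ g _ (nbhs (\sum_i c i * x ord0 i))); last exact: cg.
  have Fx : Filter (nbhs x) := nbhs_filter x.
  apply: cvg_big; first exact: add_continuous.
  by move=> i _; apply: cvgMr; exact: coord_continuous.
have := cT k u f 1 cf (fun x => g1 _); rewrite /f.
under eq_fun do under eq_Rintegral do under eq_bigr do rewrite mxE.
by under [X in _ --> X]eq_Rintegral do under eq_bigr do rewrite mxE.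
Qed.

Lemma ultra_tangent (e : nat -> R) (U : set_system nat) {uU : UltraFilter U} :
  (forall m, 0 < e m) -> e m @[m --> \oo] --> (0 : R) -> \oo `<=` U ->
  let W := g_sigma_algebraType (@measurable _ (ultrapower uU Omega)) in
  exists (Q : probability W R) (T : 'rV[R]_n -> W -> R),
    (forall u, measurable_fun setT (T u)) /\ increments_converge e U Q T.
Proof.
move=> e0 ec ooU W.
have nuU m : \forall i \near U, (m <= i)%N by apply: ooU; exact: nbhs_infty_ge.
have [Q QE] := loeb_measure_exists (uU := uU) P nuU.
have mY i u : measurable_fun setT (Y (e i) u) by exact: measurable_increment.
have tight u (r : R) : 0 < r ->
    exists K : R, \forall i \near U, fine (P [set x | K < `|Y (e i) u x|]) <= r.
  move=> r0; have [K PK] := increment_tight alpha0 hX t0 e0 ec u r0.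
  by exists K; exact: ooU.
exists Q, (@loeb_field R nat U uU _ Omega _ (fun i => Y (e i))); split.
  by move=> u; exact: (measurable_loeb_field QE mY u).
by move=> k u f M cf fM; apply: (@loeb_field_expectation _ _ _ uU _ _ P Q QE _ _ mY tight k u f M cf fM).
Qed.

(** [T] is the Loeb limit along e_m = 1/(m + 1) and one ultrafilter. For any other sequence and any
    ultrafilter, the increments converge to a Loeb limit [T'] on its own space, and [T'] integrates
    [f] as [T] does because the linear combinations of both have the same Gaussian laws. *)
Lemma tangent_exists : exists (d' : measure_display) (W : measurableType d')
    (Q : probability W R) (T : 'rV[R]_n -> W -> R),
  (forall u, measurable_fun setT (T u)) /\
  forall e : nat -> R, (forall m, 0 < e m) -> e m @[m --> \oo] --> (0 : R) ->
    increments_converge e \oo Q T.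
Proof.
have [U [uU ooU]] := @ultraFilterLemma nat \oo _.
have h0 (m : nat) : 0 < m.+1%:R^-1 :> R by rewrite invr_gt0.
have [Q [T [mT cT]]] := ultra_tangent (e := fun m => m.+1%:R^-1) h0 (@cvg_harmonic R) ooU.
exists _, _, Q, T; split=> // e e0 ec k u f M cf fM.
apply: ultra_cvg => U' uU' ooU'.
have [Q' [T' [mT' cT']]] := ultra_tangent e0 ec ooU'.
have -> : \int[Q]_w f (\row_i T (u i) w) = \int[Q']_w f (\row_i T' (u i) w).
  apply: (trig_determining (M := M)) => // c th.
  have sl := increments_converge_same_law (FF := @ultra_proper _ _ uU) h0 (@cvg_harmonic R) ooU mT cT c u.
  have sl' := increments_converge_same_law (FF := @ultra_proper _ _ uU') e0 ec ooU' mT' cT' c u.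
  have mcos : measurable_fun setT (fun x : R => cos (x + th)).
    apply: measurableT_comp; first exact: continuous_measurable_fun (@continuous_cos R).
    exact: measurable_funD.
  have mS d1 (W1 : measurableType d1) (S : 'rV[R]_n -> W1 -> R) :
      (forall v, measurable_fun setT (S v)) ->
      measurable_fun setT (fun w => \sum_i c i * S (u i) w).
    by move=> mS; apply: measurable_sum => i; exact: measurable_funM.
  rewrite (same_law_Rintegral (mS _ _ _ mT) _ sl mcos)//; last exact: measurable_funM.
  by rewrite (same_law_Rintegral (mS _ _ _ mT') _ sl' mcos)//; exact: measurable_funM.
exact: cT'.
Qed.

End TangentField.

(** * Gaussianity and covariance of an arbitrary limit field *)

Section LevyField.
Context {R : realType} {n : nat} (alpha beta : R).
Hypothesis alpha0 : 0 < alpha.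
Context {d : measure_display} {Omega : measurableType d} {P : probability Omega R}.
Variable (X : random_field n P).
Hypothesis hX : gfgcc alpha beta X.
Variable t0 : 'rV[R]_n.
Local Notation kappa := (@gaussian_variance R).
Local Notation Y := (increment alpha X t0).

Lemma limit_cov_diag (u : 'rV[R]_n) : limit_cov alpha beta u u = 2 * beta * norm_pow alpha u.
Proof. by rewrite /limit_cov subrr norm_pow0// subr0; ring. Qed.

Lemma limit_covC (u v : 'rV[R]_n) : limit_cov alpha beta u v = limit_cov alpha beta v u.
Proof.
by rewrite /limit_cov [norm_pow alpha u + _]addrC /norm_pow -(opprB v u) eucl_normN.
Qed.

Section Converging.
Context {d' : measure_display} {W : measurableType d'} (Q : probability W R)
  (T : 'rV[R]_n -> W -> R).
Hypotheses (mT : forall u, measurable_fun setT (T u))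
  (cT : forall e : nat -> R, (forall m, 0 < e m) -> e m @[m --> \oo] --> (0 : R) ->
    increments_converge alpha X t0 e \oo Q T).

Lemma converging_comb k (c : 'I_k -> R) (u : 'I_k -> 'rV[R]_n) :
  [/\ forall A : set R, measurable A -> Q ((fun w => \sum_i c i * T (u i) w) @^-1` A) =
        gaussian_law 0 (Num.sqrt (limit_var alpha beta c u / kappa)) A,
      'E_Q[fun w => (\sum_i c i * T (u i) w)%R]%E = 0%E &
      'E_Q[fun w => ((\sum_i c i * T (u i) w) ^+ 2)%R]%E = (limit_var alpha beta c u)%:E].
Proof.
have h0 (m : nat) : 0 < m.+1%:R^-1 :> R by rewrite invr_gt0.
have [i2 k0] := gfgcc_gaussian_variance alpha0 hX t0.
apply: same_law_gaussian => //.
- by apply: measurable_sum => i; exact: measurable_funM.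
- exact: (limit_var_ge0 alpha0 hX t0 h0 (@cvg_harmonic R)).
exact: (increments_converge_same_law alpha0 hX (t0 := t0) h0 (@cvg_harmonic R) (F := \oo)
  _ mT (cT h0 (@cvg_harmonic R))).
Qed.

Lemma converging_mean u : 'E_Q[T u]%E = 0%E.
Proof.
have [_ h _] := converging_comb (fun _ : 'I_1 => 1) (fun=> u).
by apply: eq_trans h; congr expectation; apply/funext => w; rewrite big_ord1 mul1r.
Qed.

Lemma converging_square u : 'E_Q[fun w => (T u w ^+ 2)%R]%E = (limit_cov alpha beta u u)%:E.
Proof.
have [_ _] := converging_comb (fun _ : 'I_1 => 1) (fun=> u).
rewrite /limit_var !big_ord1 !mul1r => h.
by apply: eq_trans h; congr expectation; apply/funext => w; rewrite big_ord1 mul1r.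
Qed.

Lemma converging_cov u v : 'E_Q[fun w => (T u w * T v w)%R]%E = (limit_cov alpha beta u v)%:E.
Proof.
pose t (i : 'I_2) := if i == 0 then u else v.
pose m s := limit_cov alpha beta u u + 2 * s * limit_cov alpha beta u v
  + s ^+ 2 * limit_cov alpha beta v v.
have sq s : 'E_Q[fun w => ((T u w + s * T v w) ^+ 2)%R]%E = (m s)%:E.
  have [_ _ h] := converging_comb (fun i : 'I_2 => if i == 0 then 1 else s) t.
  transitivity ('E_Q[fun w =>
      ((\sum_i (if i == 0 :> 'I_2 then 1 else s) * T (t i) w) ^+ 2)%R])%E.
    by congr expectation; apply/funext => w; rewrite !big_ord_recl big_ord0 /t/= mul1r addr0.
  rewrite h; congr EFin; rewrite /limit_var !big_ord_recl !big_ord0 /m /t/= (limit_covC v u).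
  by move: (limit_cov _ _ _ _) (limit_cov _ _ _ _) (limit_cov _ _ _ _) => x y z; ring.
have isq s : Q.-integrable setT (fun w => ((T u w + s * T v w) ^+ 2)%:E).
  have m2 : measurable_fun setT (fun w => (T u w + s * T v w) ^+ 2).
    by apply: measurable_funX; apply: measurable_funD => //; exact: measurable_funM.
  apply/integrableP; split; first exact/measurable_EFinP.
  under eq_integral do rewrite gee0_abs ?lee_fin ?sqr_ge0//.
  by move: (sq s); rewrite expectation.unlock => ->; rewrite ltry.
(* Polarization: xy = ((x + y)^2 - (x - y)^2) / 4. *)
have [_] := expectation_lin [:: 1; -1] (fun s => s / 4) isq sq.
move=> h; transitivity ('E_Q[fun w =>
    (\sum_(s <- [:: 1; -1]) s / 4 * (T u w + s * T v w) ^+ 2)%R])%E.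
  congr expectation; apply/funext => w; rewrite !big_cons big_nil.
  by move: (T u w) (T v w) => x y; field.
rewrite {}h; congr EFin; rewrite !big_cons big_nil /m.
by move: (limit_cov _ _ _ _) (limit_cov _ _ _ _) (limit_cov _ _ _ _) => x y z; field.
Qed.

End Converging.
End LevyField.

Unset Implicit Arguments.
Set Strict Implicit.
Set Printing Implicit Defensive.

(* The factor Num.sqrt (2 * beta) is forced by the normalisations: the variance
   of X (t0 + eps u) - X t0 is equivalent to 2 beta eps^alpha |u|^alpha, while
   the Levy field has variance |u|^alpha. *)
Theorem proposition2p4 (R : realType) (n : nat) (hn : (0 < n)%N)
    (alpha beta : R) (halpha : 0 < alpha <= 2) (hbeta : 0 < beta)
    (d : measure_display) (Omega : measurableType d) (P : probability Omega R)
    (X : random_field n P) (hX : gfgcc alpha beta X) (t0 : 'rV[R]_n) :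
  lass_at X t0 (alpha / 2) /\
  forall (d' : measure_display) (Omega' : measurableType d')
    (Q : probability Omega' R) (T : random_field n Q),
    tangent_field X t0 (alpha / 2) T ->
    exists B : random_field n Q,
      levy_fbf (alpha / 2) B /\
      forall u w, T u w = Num.sqrt (2 * beta) * B u w.

Proof.
have /andP[alpha0 _] := halpha.
have tn0 : 0 < 2 * beta by rewrite mulr_gt0.
pose Y eps u (w : Omega) := eps `^ (- (alpha / 2)) * (X (t0 + eps *: u) w - X t0 w).
have bY eps k (u : 'I_k -> 'rV[R]_n) f (M : R) : continuous f -> (forall x, `|f x| <= M) ->
    bounded_rv (fun w => f (\row_i Y eps (u i) w)).
  move=> cf fM; apply: (row_sin_Rintegral_cvg P _ cf fM).1 => i.
  exact: (measurable_increment alpha X t0 eps (u i)).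
split.
  have [d' [W [Q [T [mT cT]]]]] := tangent_exists alpha0 hX t0.
  pose T' u : {RV Q >-> R} := HB.pack (T u) (isMeasurableFun.Build _ _ _ _ (T u) (mT u)).
  exists d', W, Q, T'; split.
    (* At the all-ones vector the variance is 2 beta |u|^alpha, and the norm is positive since
       [0 < n]; a variable null almost everywhere would have variance 0. *)
    exists (const_mx 1) => T0.
    have := converging_square alpha0 hX mT cT (const_mx 1).
    rewrite expectation.unlock (ae_eq_integral (cst 0%E)) => //.
    - rewrite integral0 limit_cov_diag// => -[] /esym/eqP.
      rewrite mulf_eq0 (gt_eqF tn0)/= gt_eqF// /norm_pow powR_gt0// sqrtr_gt0.
      rewrite (eq_bigr (fun=> 1)) => [|i _]; last by rewrite mxE expr1n.
      by rewrite sumr_const card_ord ltr0n.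
    - by apply/measurable_EFinP; exact: measurable_funX.
    - by apply: filterS T0 => w /= -> _; rewrite expr0n.
  move=> k u f cf [M fM].
  rewrite (expectation_bounded Q (row_sin_Rintegral_cvg Q (fun i => mT (u i)) cf fM).1).
  under eq_fun do rewrite (expectation_bounded P (bY _ _ u _ _ cf fM)).
  apply: cvg_EFin; first exact: nearW.
  (* Convergence as eps tends to 0 from the right is tested on positive sequences tending to 0. *)
  apply/cvg_at_rightP => e [e0 ec]; exact: cT cf fM.
move=> d' W Q T [_ cT0].
have mT u : measurable_fun setT (T u) by [].
have cT (e : nat -> R) : (forall m, 0 < e m) -> e m @[m --> \oo] --> (0 : R) ->
    increments_converge alpha X t0 e \oo Q (fun u => T u : W -> R).
  move=> e0 ec k u f M cf fM.
  have := cT0 k u f cf (ex_intro _ M fM).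
  rewrite (expectation_bounded Q (row_sin_Rintegral_cvg Q (fun i => mT (u i)) cf fM).1).
  under eq_fun do rewrite (expectation_bounded P (bY _ _ u _ _ cf fM)).
  by move=> /fine_cvg/cvg_at_rightP; apply; split.
(* With B = b T, the factor b^2 beta in the covariance becomes 1/2. *)
pose b := (Num.sqrt (2 * beta))^-1.
have b0 : 0 < b by rewrite invr_gt0 sqrtr_gt0.
have mB u : measurable_fun setT (fun w => b * T u w) by exact: measurable_funM.
pose B u : {RV Q >-> R} := HB.pack (fun w => b * T u w)
  (isMeasurableFun.Build _ _ _ _ (fun w => b * T u w) (mB u)).
exists B; split; last by move=> u w /=; rewrite mulrA divff ?mul1r// -invr_eq0 gt_eqF.
split.
- move=> k t c.
  have [law _ _] := converging_comb alpha0 hX mT cT (fun i => c i * b) t.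
  exists 0, (Num.sqrt (limit_var alpha beta (fun i => c i * b) t / gaussian_variance)).
  move=> A mA; rewrite -law//; congr (Q (_ @^-1` A)); apply/funext => w.
  by apply: eq_bigr => i _; rewrite mulrA.
- move=> t; have iT := integrable_fst mT (converging_cov alpha0 hX mT cT) t.
  have [_] := expectation_lin [:: tt] (fun=> b) (fun=> iT) (fun=> converging_mean alpha0 hX mT cT t : _ = 0%:E).
  rewrite big_seq1 mulr0 => h; apply: eq_trans h; congr expectation.
  by apply/funext => w; rewrite big_seq1.
- move=> u v.
  have iT := integrable_mul mT (converging_cov alpha0 hX mT cT) u v.
  have [_] := expectation_lin [:: tt] (fun=> b ^+ 2) (fun=> iT)
    (fun=> converging_cov alpha0 hX mT cT u v).
  rewrite big_seq1 => h; transitivity ('E_Q[fun w =>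
      (\sum_(i <- [:: tt]) b ^+ 2 * (T u w * T v w))%R])%E.
    by congr expectation; apply/funext => w; rewrite big_seq1 /=; ring.
  rewrite {}h; congr EFin; rewrite /b exprVn sqr_sqrtr ?ltW// /limit_cov /norm_pow.
  have -> : 2 * (alpha / 2) = alpha by field.
  by field; rewrite gt_eqF.
Qed.
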